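(* Assume $\gamma_2=\epsilon^t$ with $1/2<t<1$ and $\gamma_1=\epsilon^s$ with $t<s<1+t$ (for $0<\epsilon<1$), and additionally assume that $s>(t+1)/3$. Let $T_1,T_2,T=T_2\circ T_1$ be the maps (depending on $\epsilon$) defined in the context, let $\mathcal{U}_0:=T_2(0)$ and $\mathcal{U}_1:=T(\mathcal{U}_0)$, and let $\alpha_0:=T_1(\mathcal{U}_0)$ and $\alpha_1:=T_1(\mathcal{U}_1)$. Then $$\lim_{\epsilon\downarrow 0}\frac{\alpha_1-\alpha_0}{\epsilon^2}=0 .$$
   Context: Roughness and micro-domain. $\varphi:\mathbb{R}\to\mathbb{R}$ is a fixed bounded, Lipschitz continuous, $1$-periodic function with $\varphi\ge 0$, $H:=\|\varphi\|_\infty>0$, and $\varphi(N)=H$ for every $N\in\mathbb{Z}$. For small $\epsilon>0$ put $M:=\epsilon H$. The rough boundary (whose maximum height is $x_2=0$) is $\Gamma_\epsilon=\{(x_1,x_2): 0\le x_1\le\epsilon,\ x_2=\epsilon\varphi(x_1/\epsilon)-\epsilon H\}$. For heights $0<\gamma_1<\gamma_2<1$ (which may depend on $\epsilon$) the micro-domain is $\Omega^{\rm mic}=\{(x_1,x_2):0<x_1<\epsilon,\ \epsilon\varphi(x_1/\epsilon)-\epsilon H<x_2<\gamma_2\}$. Let $e_1=(1,0)$. Auxiliary Stokes flows. All flows in $\Omega^{\rm mic}$ are velocity–pressure pairs, $\epsilon$-periodic in $x_1$ (periodic at the side walls $x_1=0$ and $x_1=\epsilon$), solving the homogeneous Stokes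 system $-\Delta u+\nabla p=0$, $\nabla\cdot u=0$ (weakly). (i) $u_2$ is the solution with $u_2=0$ at $x_2=\gamma_2$ and $u_2=-(x_2+M)(\gamma_2-x_2)\,e_1$ on $\Gamma_\epsilon$. (ii) $\tilde u_3$ is the solution with $\tilde u_3=e_1$ at $x_2=\gamma_2$ and $\tilde u_3=0$ on $\Gamma_\epsilon$. Define the real numbers $\overline{B}_2:=\int_0^\epsilon u_2(x_1,0)\cdot e_1\,dx_1$ and $\tilde B_3:=\int_0^\epsilon\tilde u_3(x_1,0)\cdot e_1\,dx_1$. Maps. The macro-to-micro map is $$T_2(\alpha):=-\gamma_2^2+\left(\frac{\gamma_1^2-1-2\gamma_1\alpha}{\gamma_1-1-\alpha}\right)(\gamma_2-1)+1 ,$$ considered for $\alpha\ge0$ and, by the same formula, wherever its denominator is nonzero. The micro-to-macro map is $$T_1(\mathcal{U}):=\frac{C_1+C_2\,\mathcal{U}}{C_3+(1-\tilde B_3)\,\mathcal{U}},\qquad \mathcal{U}\in\mathbb{R},$$ (wherever its denominator is nonzero), with $C_1=\epsilon\gamma_2(\gamma_1+M)(\gamma_2-\gamma_1)+\overline{B}_2(\gamma_2-\gamma_1)$, $C_2=\tilde B_3(\gamma_2-\gamma_1)+\gamma_1$, $C_3=\epsilon\gamma_2(\gamma_2-2\gamma_1-M)-\overline{B}_2$. Finally $T(\mathcal{U}):=T_2(T_1(\mathcal{U}))$. All these objects depend on $\epsilon$. *)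

(* Defs.v *)
From HB Require Import structures.
From mathcomp Require Import all_boot all_order all_algebra.
From mathcomp Require Import all_classical all_reals all_analysis.

Set Implicit Arguments.
Unset Strict Implicit.
Unset Printing Implicit Defensive.

Import Order.TTheory GRing.Theory Num.Theory.
Import numFieldNormedType.Exports.

Local Open Scope classical_set_scope.
Local Open Scope ring_scope.

Section Geometry.
Context {R : realType}.

Definition sup_norm (phi : R -> R) : R := sup (range (fun x => `|phi x|)).

Definition rough_bottom (phi : R -> R) (eps : R) : R -> R :=
  fun x => eps * phi (x / eps) - eps * sup_norm phi.

Definition Omega_mic (phi : R -> R) (eps gamma2 : R) : set (R * R) :=
  [set z | 0 < z.1 < eps /\ rough_bottom phi eps z.1 < z.2 < gamma2].

End Geometry.

(* The closure H^1_per of the continuously differentiable functions of the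
   plane that are eps-periodic in x_1, for the H^1 norm on a domain.  A weak
   gradient is carried along explicitly as a pair of functions. *)
Section Sobolev.
Context {R : realType}.
Notation mu1 := (@lebesgue_measure R).
Notation mu2 := (mu1 \x mu1)%E.

Definition in_L2 d (T : measurableType d) (mu : set T -> \bar R) (D : set T)
    (f : T -> R) : Prop :=
  measurable_fun D f /\ (\int[mu]_(z in D) ((f z) ^+ 2)%:E < +oo)%E.

Definition L2_cvg d (T : measurableType d) (mu : set T -> \bar R) (D : set T)
    (f_ : nat -> T -> R) (f : T -> R) : Prop :=
  (fun n => \int[mu]_(z in D) ((f_ n z - f z) ^+ 2)%:E)%E @ \oo --> 0%E.

Definition e1 : R * R := (1, 0).
Definition e2 : R * R := (0, 1).

Definition C1_per (eps : R) (v : R * R -> R) : Prop :=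
  [/\ forall z, v (z.1 + eps, z.2) = v z,
      continuous v,
      forall z, derivable v z e1 /\ derivable v z e2,
      continuous ('D_e1 v) & continuous ('D_e2 v)].

Definition H1_cvg (D : set (R * R)) (v_ : nat -> R * R -> R)
    (u : R * R -> R) (du : R * R -> R * R) : Prop :=
  [/\ L2_cvg mu2 D v_ u,
      L2_cvg mu2 D (fun n => 'D_e1 (v_ n)) (fst \o du) &
      L2_cvg mu2 D (fun n => 'D_e2 (v_ n)) (snd \o du)].

(* u belongs to H^1_per(D) and has weak gradient du. *)
Definition H1_per (eps : R) (D : set (R * R))
    (u : R * R -> R) (du : R * R -> R * R) : Prop :=
  [/\ in_L2 mu2 D u, in_L2 mu2 D (fst \o du), in_L2 mu2 D (snd \o du) &
      exists2 v_ : nat -> R * R -> R,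
        forall n, C1_per eps (v_ n) & H1_cvg D v_ u du].

(* tau is the trace of u along the graph x_2 = h(x_1), 0 < x_1 < eps: the trace
   operator is the continuous extension to H^1 of the restriction of functions
   that are C^1 up to the boundary.  Parametrizing the graph by x_1 gives an L^2
   norm equivalent to that of arc length, h being Lipschitz continuous. *)
Definition trace_on (eps : R) (D : set (R * R)) (h : R -> R)
    (u : R * R -> R) (tau : R -> R) : Prop :=
  in_L2 mu1 `]0, eps[ tau /\
  exists2 du, H1_per eps D u du &
  exists v_ : nat -> R * R -> R,
    [/\ forall n, C1_per eps (v_ n), H1_cvg D v_ u du &
        L2_cvg mu1 `]0, eps[ (fun n x => v_ n (x, h x)) tau].

Definition vtrace_on (eps : R) (D : set (R * R)) (h : R -> R)
    (u : R * R -> R * R) (tau : R -> R * R) : Prop :=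
  trace_on eps D h (fst \o u) (fst \o tau) /\
  trace_on eps D h (snd \o u) (snd \o tau).

End Sobolev.

Section Stokes.
Context {R : realType}.
Variables (phi : R -> R) (eps gamma2 : R).
Notation mu1 := (@lebesgue_measure R).
Notation mu2 := (mu1 \x mu1)%E.
Notation Omega := (Omega_mic phi eps gamma2).

Definition vH1_per (u : R * R -> R * R) (du1 du2 : R * R -> R * R) : Prop :=
  H1_per eps Omega (fst \o u) du1 /\ H1_per eps Omega (snd \o u) du2.

(* The pressure is a general element of L^2; its periodicity, like that of the
   normal stress, is enforced by the periodicity of the test fields psi. *)
Definition stokes_periodic (u : R * R -> R * R) (p : R * R -> R) : Prop :=
  in_L2 mu2 Omega p /\
  exists du1 du2 : R * R -> R * R,
  [/\ vH1_per u du1 du2,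
      {ae mu2, forall z, Omega z -> (du1 z).1 + (du2 z).2 = 0} &
      forall (psi dpsi1 dpsi2 : R * R -> R * R),
        vH1_per psi dpsi1 dpsi2 ->
        vtrace_on eps Omega (rough_bottom phi eps) psi (cst 0) ->
        vtrace_on eps Omega (cst gamma2) psi (cst 0) ->
        (\int[mu2]_(z in Omega)
           ((du1 z).1 * (dpsi1 z).1 + (du1 z).2 * (dpsi1 z).2
            + (du2 z).1 * (dpsi2 z).1 + (du2 z).2 * (dpsi2 z).2
            - p z * ((dpsi1 z).1 + (dpsi2 z).2))%:E = 0)%E].

Definition flow_u2 (u : R * R -> R * R) (p : R * R -> R) : Prop :=
  let h := rough_bottom phi eps in
  let M := eps * sup_norm phi in
  [/\ stokes_periodic u p,
      vtrace_on eps Omega (cst gamma2) u (cst 0) &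
      vtrace_on eps Omega h u
        (fun x => - ((h x + M) * (gamma2 - h x)) *: (e1 : R * R))].

Definition flow_u3 (u : R * R -> R * R) (p : R * R -> R) : Prop :=
  [/\ stokes_periodic u p,
      vtrace_on eps Omega (cst gamma2) u (cst e1) &
      vtrace_on eps Omega (rough_bottom phi eps) u (cst 0)].

(* b is the integral over 0 < x_1 < eps of u(x_1, 0) . e_1. *)
Definition slice_integral (u : R * R -> R * R) (b : R) : Prop :=
  exists2 tau, trace_on eps Omega (cst 0) (fst \o u) tau &
    b = \int[mu1]_(x in `]0, eps[) tau x.

End Stokes.

Section Maps.
Context {R : realType}.

Definition T2_den (gamma1 alpha : R) : R := gamma1 - 1 - alpha.

Definition T2 (gamma1 gamma2 alpha : R) : R :=
  - gamma2 ^+ 2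
  + (gamma1 ^+ 2 - 1 - 2 * gamma1 * alpha) / T2_den gamma1 alpha * (gamma2 - 1)
  + 1.

Definition C1 (eps M gamma1 gamma2 B2 : R) : R :=
  eps * gamma2 * (gamma1 + M) * (gamma2 - gamma1) + B2 * (gamma2 - gamma1).

Definition C2 (gamma1 gamma2 B3 : R) : R := B3 * (gamma2 - gamma1) + gamma1.

Definition C3 (eps M gamma1 gamma2 B2 : R) : R :=
  eps * gamma2 * (gamma2 - 2 * gamma1 - M) - B2.

Definition T1_den (eps M gamma1 gamma2 B2 B3 U : R) : R :=
  C3 eps M gamma1 gamma2 B2 + (1 - B3) * U.

Definition T1 (eps M gamma1 gamma2 B2 B3 U : R) : R :=
  (C1 eps M gamma1 gamma2 B2 + C2 gamma1 gamma2 B3 * U)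
  / T1_den eps M gamma1 gamma2 B2 B3 U.

End Maps.

(* Main.v *)
Require Import Defs.
From mathcomp Require Import all_boot all_order all_algebra.
From mathcomp Require Import all_classical all_reals all_analysis.
From mathcomp Require Import measurable_realfun ring lra.

Import Order.TTheory GRing.Theory Num.Theory.
Import numFieldNormedType.Exports.

Local Open Scope classical_set_scope.
Local Open Scope ring_scope.

(** The flow quantities enter through two sizes only: with [g2 = eps `^ t],
    [|B2| = O(eps * g2 ^+ 2)] and [|B3| = O(eps)].

    Both come from one energy argument.  Suppose that the boundary values of the
    flow [u] are those of a shear flow [(v x_2, 0)] with [v] of class C^1.  Shear
    flows are divergence free, so [u] minus the shear flow is an admissible test
    field against which the pressure does no work, and testing with it bounds the
    energy carried by the vertical derivative of [u_1] by the energy of the shear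
    flow ([shear_energy]).  Integrating that derivative over the
    rectangle above [x_2 = 0] gives [eps * v g2 - b], where [b] is the slice
    integral ([strip_increment]), and the Cauchy-Schwarz inequality turns the
    energy estimate into a bound on [eps * v g2 - b] ([slice_bound]).  For [u_2]
    the boundary data are already the restriction of a quadratic shear flow; for
    the flow driven from the top, [v y = (max 0 y / g2) ^+ 2] vanishes on the
    whole rough boundary because the latter lies below [x_2 = 0].

    The increment over the rectangle needs the traces on its two sides, and the
    weak gradients that come with the two traces and with the Stokes equations
    are a priori different functions.  The first two are tested against powers of
    affine functions of [x_2] that concentrate on a side, and the third against
    what these leave of the constant [1]: the terms in [u] cancel, and the
    boundary layers vanish in the limit.

    What remains is algebra of homographies.  With the above sizes [U0] is
    comparable to [g2] and dominates the denominator of [T1]; hence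
    [T1 (U0) = O(g1)], so that [U1 - U0 = O(g1)], and the difference of two values
    of a homography carries its determinant, which is [O(eps * g2 ^+ 3)] here.
    Altogether [alpha1 - alpha0 = O(eps * g1 * g2)] ([alpha_increment]), and
    [eps * g1 * g2 / eps ^+ 2 = eps `^ (s + t - 1)] tends to [0] since
    [s > t > 1 / 2]. *)

(** * Square integrable functions *)

Lemma open_measurable_plane (R : realType) (O : set (R * R)) :
  open O -> measurable O.
Proof.
move=> oO.
(* An open set is the union of the rational open rectangles that it contains. *)
pose rect (q : rat * rat * rat * rat) : set (R * R) :=
  `]ratr q.1.1.1, ratr q.1.1.2[ `*` `]ratr q.1.2, ratr q.2[.
pose F (i : nat) : set (R * R) :=
  if unpickle i is Some q then if `[< rect q `<=` O >] then rect q else set0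
  else set0.
have -> : O = \bigcup_i F i.
  apply/seteqP; split => [[x y] Oxy|z [i _]]; last first.
    by rewrite /F; case: unpickle => [q|//]; case: asboolP => // + ?; apply.
  have : nbhs (x, y) O by exact: open_nbhs_nbhs.
  rewrite -nbhs_ballE => -[e /= e0 xyO].
  have lt_nbr z : z - e < z < z + e by apply/andP; split; lra.
  have [/rat_in_itvoo[a xa] /rat_in_itvoo[b xb]] := andP (lt_nbr x).
  have [/rat_in_itvoo[c yc] /rat_in_itvoo[f yf]] := andP (lt_nbr y).
  move: xa xb yc yf.
  rewrite !in_itv/= => /andP[? ?] /andP[? ?] /andP[? ?] /andP[? ?].
  exists (pickle (a, b, c, f)); [exact: I|rewrite /F pickleK].
  case: asboolP => [_|]; first by split; rewrite /= in_itv/=; apply/andP.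
  case=> -[z1 z2] [] /=; rewrite !in_itv/= => /andP[? ?] /andP[? ?].
  by apply: xyO; split; rewrite /ball/= ltr_norml; apply/andP; split; lra.
apply: bigcupT_measurable => i; rewrite /F.
case: unpickle => [q|]; last exact: measurable0.
by case: asboolP => _; [exact: measurableX|exact: measurable0].
Qed.

Lemma continuous_measurable_plane (R : realType) (f : R * R -> R)
  (D : set (R * R)) : continuous f -> measurable_fun D f.
Proof.
move=> /continuousP cf; apply: measurable_funTS.
apply: (measurability _ (RGenOpens.measurableE R)).
move=> _ [_ [a [b ->] <-]]; rewrite setTI.
by apply: open_measurable_plane; apply: cf; exact: interval_open.
Qed.

Section L2.
Context d (T : measurableType d) (R : realType).
Variables (mu : {measure set T -> \bar R}) (D : set T).
Hypothesis mD : measurable D.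
Implicit Types f g : T -> R.

Lemma in_L2_integrable_sqr f :
  in_L2 mu D f -> mu.-integrable D (EFin \o (fun x => f x ^+ 2)).
Proof.
move=> [mf foo]; apply/integrableP; split.
  by apply/measurable_EFinP; exact: measurable_funX.
apply: le_lt_trans foo; under eq_integral do rewrite /= ger0_norm ?sqr_ge0//.
exact: lexx.
Qed.

Lemma in_L2_integrableM f g : in_L2 mu D f -> in_L2 mu D g ->
  mu.-integrable D (EFin \o (fun x => f x * g x)).
Proof.
move=> f2 g2.
have := integrableD mD (in_L2_integrable_sqr _ f2) (in_L2_integrable_sqr _ g2).
apply: le_integrable => //.
  by apply/measurable_EFinP/measurable_funM; [exact: f2.1|exact: g2.1].
move=> x _; rewrite /= lee_fin normrM.
rewrite (@ger0_norm _ (f x ^+ 2 + _)) ?addr_ge0 ?sqr_ge0//.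
have := sqr_ge0 (`|f x| - `|g x|).
by rewrite -(real_normK (num_real (f x))) -(real_normK (num_real (g x))); nra.
Qed.

Lemma in_L2_lin f g a b : in_L2 mu D f -> in_L2 mu D g ->
  in_L2 mu D (fun x => a * f x + b * g x).
Proof.
move=> f2 g2; split.
  by apply: measurable_funD; apply: measurable_funM => //;
    [exact: f2.1|exact: g2.1].
have : mu.-integrable D (EFin \o (fun x => (a * f x + b * g x) ^+ 2)).
  have fg := integrableZl mD (2 * a * b) (in_L2_integrableM _ _ f2 g2).
  have := integrableD mD (integrableZl mD (a ^+ 2) (in_L2_integrable_sqr _ f2))
    (integrableZl mD (b ^+ 2) (in_L2_integrable_sqr _ g2)).
  move=> /(integrableD mD fg); apply: eq_integrable => // x _ /=.
  by rewrite -!EFinM -!EFinD; congr EFin; ring.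
by move=> /integrable_lty; apply.
Qed.

Lemma in_L2B f g : in_L2 mu D f -> in_L2 mu D g ->
  in_L2 mu D (fun x => f x - g x).
Proof.
move=> f2 g2; have := in_L2_lin _ _ 1 (-1) f2 g2.
by under eq_fun do rewrite mul1r mulN1r.
Qed.

Lemma in_L2_bounded f (K : R) : (mu D < +oo)%E -> measurable_fun D f ->
  (forall x, D x -> `|f x| <= K) -> in_L2 mu D f.
Proof.
move=> Doo mf fK; split => //.
have : mu.-integrable D (EFin \o (fun x => f x ^+ 2)).
  apply: measurable_bounded_integrable => //; first exact: measurable_funX.
  exists (K ^+ 2); split => [|M KM x Dx /=]; first exact: num_real.
  rewrite normrX.
  have := fK _ Dx; have := normr_ge0 (f x); nra.
by move=> /integrable_lty; apply.
Qed.

Lemma cauchy_schwarz f g : in_L2 mu D f -> in_L2 mu D g ->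
  (\int[mu]_(x in D) (f x * g x)) ^+ 2 <=
  \int[mu]_(x in D) (f x ^+ 2) * \int[mu]_(x in D) (g x ^+ 2).
Proof.
move=> f2 g2; have f2i := in_L2_integrable_sqr _ f2.
have g2i := in_L2_integrable_sqr _ g2; have fgi := in_L2_integrableM _ _ f2 g2.
set A := \int[mu]_(x in D) (f x ^+ 2); set B := \int[mu]_(x in D) (f x * g x).
set C := \int[mu]_(x in D) (g x ^+ 2).
have quad s : 0 <= A + 2 * s * B + s ^+ 2 * C.
  have : 0 <= \int[mu]_(x in D) ((f x + s * g x) ^+ 2).
    by apply: Rintegral_ge0 => x _; exact: sqr_ge0.
  rewrite (_ : \int[mu]_(x in D) _ = A + 2 * s * B + s ^+ 2 * C)//.
  have i1 : mu.-integrable D (EFin \o (fun x => 2 * s * (f x * g x))).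
    exact: (integrableZl mD (2 * s) fgi).
  have i2 : mu.-integrable D (EFin \o (fun x => s ^+ 2 * g x ^+ 2)).
    exact: (integrableZl mD (s ^+ 2) g2i).
  have i3 := integrableD mD f2i i1.
  rewrite -!RintegralZl// -!RintegralD//.
  by apply: eq_Rintegral => x _; ring.
have C0 : 0 <= C by apply: Rintegral_ge0 => x _; exact: sqr_ge0.
have A0 : 0 <= A by apply: Rintegral_ge0 => x _; exact: sqr_ge0.
move: C0; rewrite le_eqVlt => /predU1P[C0|C0]; last first.
  have := mulr_ge0 (quad (- (B / C))) (ltW C0).
  have -> : (A + 2 * - (B / C) * B + (- (B / C)) ^+ 2 * C) * C = A * C - B ^+ 2.
    by field; rewrite gt_eqF.
  by rewrite subr_ge0.
(* The form is affine in [s]: a nonzero slope would make it take the value -1. *)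
rewrite -C0 mulr0; have [->|B0] := eqVneq B 0; first by rewrite expr0n.
have := quad (- ((A + 1) / (2 * B))); rewrite -C0.
have -> : A + 2 * - ((A + 1) / (2 * B)) * B + (- ((A + 1) / (2 * B))) ^+ 2 * 0
          = -1 by field.
by rewrite ler0N1.
Qed.

Lemma L2_cvg_Rintegral (f_ : nat -> T -> R) f g :
  (forall n, measurable_fun D (f_ n)) -> in_L2 mu D f -> in_L2 mu D g ->
  L2_cvg mu D f_ f ->
  \int[mu]_(x in D) (f_ n x * g x) @[n --> \oo] --> \int[mu]_(x in D) (f x * g x).
Proof.
move=> mf_ f2 g2 f_f.
pose e n := (\int[mu]_(z in D) ((f_ n z - f z) ^+ 2)%:E)%E.
have [e_fin e_cvg] : (\forall n \near \oo, e n \is a fin_num) /\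
    fine \o e @ \oo --> (0 : R) by apply/fine_cvgP.
set G := \int[mu]_(x in D) (g x ^+ 2).
apply/subr_cvg0/norm_cvg0P.
apply: (@squeeze_cvgr _ _ _ _ (cst 0) (fun n => Num.sqrt (fine (e n) * G))).
- near=> n; rewrite normr_ge0/=.
  have d2 : in_L2 mu D (fun x => f_ n x - f x).
    split; first by apply: measurable_funB => //; exact: f2.1.
    rewrite -ge0_fin_numE; first by near: n.
    by apply: integral_ge0 => x _; rewrite lee_fin sqr_ge0.
  have fn2 : in_L2 mu D (f_ n).
    have := in_L2_lin _ _ 1 1 d2 f2.
    by under eq_fun do rewrite !mul1r subrK.
  rewrite -RintegralB//; try exact: in_L2_integrableM.
  rewrite -sqrtr_sqr ler_wsqrtr//.
  under eq_Rintegral do rewrite -mulrBl.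
  exact: cauchy_schwarz.
- exact: cvg_cst.
- rewrite -[X in _ --> X]sqrtr0; apply: continuous_cvg; first exact: sqrt_continuous.
  by rewrite -(mul0r G); apply: cvgMl.
Unshelve. all: by end_near. Qed.

End L2.

(** * Integration by parts on a rectangle *)

Section Strip.
Context {R : realType}.
Notation mu1 := (@lebesgue_measure R).
Notation mu2 := (mu1 \x mu1)%E.

Definition strip (eps g : R) : set (R * R) := `]0, eps[ `*` `]0, g[.

Lemma measurable_strip eps g : measurable (strip eps g).
Proof. by apply: measurableX; exact: measurable_itv. Qed.

Lemma lebesgue_measure_itv0 (a : R) : 0 <= a ->
  mu1 (`]0, a[%classic : set R) = a%:E.
Proof.
move=> a0; rewrite lebesgue_measure_itv/= lte_fin.
case: ltP => [_|a0']; first by rewrite oppr0 adde0.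
by congr EFin; apply/le_anti/andP.
Qed.

Lemma strip_measure eps g : 0 <= eps -> 0 <= g ->
  mu2 (strip eps g) = (eps * g)%:E.
Proof.
move=> e0 g0; rewrite /strip product_measure1E//.
have -> : (eps * g)%:E = (eps%:E * g%:E)%E by [].
by rewrite -(lebesgue_measure_itv0 _ e0) -(lebesgue_measure_itv0 _ g0).
Qed.

Lemma strip_lty eps g : 0 < eps -> 0 < g -> (mu2 (strip eps g) < +oo)%E.
Proof. by move=> e0 g0; rewrite strip_measure ?ltW// ltry. Qed.

Lemma is_derive_slice (v : R * R -> R) x y : derivable v (x, y) e2 ->
  is_derive y (1 : R) (fun y => v (x, y)) ('D_e2 v (x, y)).
Proof.
move=> dv.
have E : (fun h : R => h^-1 *: (v (x, h *: 1 + y) - v (x, y))) =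
         (fun h : R => h^-1 *: (v (h *: e2 + (x, y)) - v (x, y))).
  apply/funext => h; congr (_ *: (v _ - _)).
  by rewrite /e2; congr pair; rewrite /= ?mulr0 ?scaler0 ?add0r.
by split; [rewrite /derivable E|rewrite /derive E].
Qed.

Lemma continuous_strip_bounded (eps g : R) (F : R * R -> R) : continuous F ->
  [bounded F x | x in strip eps g].
Proof.
move=> cF; have : compact (`[0, eps] `*` `[0, g] : set (R * R)).
  by apply: compact_setX; exact: segment_compact.
move=> /(continuous_compact (continuous_subspaceT cF))/compact_bounded.
case=> K [Kr HK]; exists K; split => // M KM z Sz; apply: (HK M KM).
exists z => //; case: Sz => z1 z2; split; exact: subset_itv_oo_cc.
Qed.

Lemma continuous_in_L2_strip (eps g : R) (F : R * R -> R) :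
  0 < eps -> 0 < g -> continuous F -> in_L2 mu2 (strip eps g) F.
Proof.
move=> eps0 g0 cF.
have [K [_ /(_ (K + 1))]] := continuous_strip_bounded eps g _ cF.
rewrite ltrDl ltr01 => /(_ isT) FK.
apply: (@in_L2_bounded _ _ _ mu2 _ _ _ (K + 1)).
- exact: measurable_strip.
- exact: strip_lty.
- exact: continuous_measurable_plane.
- exact: FK.
Qed.

(** The integrand is the vertical derivative of [v z * eta z.2]: Fubini's theorem
    reduces the claim to the fundamental theorem of calculus on vertical lines. *)
Lemma strip_FTC (eps g : R) (v : R * R -> R) (eta eta' : R -> R) :
  0 < eps -> 0 < g -> C1_per eps v ->
  (forall y : R, is_derive y (1 : R) eta (eta' y)) -> continuous eta' ->
  \int[mu2]_(z in strip eps g) ('D_e2 v z * eta z.2 + v z * eta' z.2) =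
  \int[mu1]_(x in `]0, eps[) (v (x, g) * eta g - v (x, 0) * eta 0).
Proof.
move=> eps0 g0 [_ cv dv _ cDv] deta ceta'.
have ceta : continuous eta.
  move=> y; apply: differentiable_continuous; apply/derivable1_diffP.
  exact: (@ex_derive _ _ _ _ _ _ _ (deta y)).
pose F (z : R * R) : R := 'D_e2 v z * eta z.2 + v z * eta' z.2.
have csnd (h : R -> R) : continuous h -> continuous (fun z : R * R => h z.2).
  by move=> ch z; apply: continuous_comp; [exact: cvg_snd|exact: ch].
have cF : continuous F.
  move=> z; apply: (@cvgD _ _ _ _ _ (fun z => 'D_e2 v z * eta z.2)
    (fun z => v z * eta' z.2)); apply: cvgM;
    by [exact: cDv|exact: (csnd eta)|exact: cv|exact: (csnd eta')].
have cFx x : continuous (fun y => F (x, y)).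
  move=> y; apply: (@continuous_comp _ _ _ (fun y => (x, y)) F); last exact: cF.
  exact: cvg_pair (cvg_cst _) cvg_id.
have mF : measurable_fun setT F by exact: continuous_measurable_plane.
have mS := measurable_strip eps g.
have iF : mu2.-integrable (strip eps g) (EFin \o F).
  apply: measurable_bounded_integrable => //.
  - exact: strip_lty.
  - exact: measurable_funTS.
  - exact: continuous_strip_bounded.
have iFT : mu2.-integrable setT ((EFin \o F) \_ (strip eps g)).
  by rewrite -integrable_mkcond.
rewrite /Rintegral integral_mkcond -(integral12_prod_meas1 iFT).
rewrite /fubini_F [in RHS]integral_mkcond; congr fine.
apply: eq_integral => x _.
rewrite [RHS]patchE; case: ifPn => [|/negP] xe; last first.
  apply: integral0_eq => y _; rewrite patchE; case: ifPn => // /set_mem[/= x0 _].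
  by case: xe; apply/mem_set.
transitivity (\int[mu1]_(y in `[0%R, g]) (F (x, y))%:E)%E.
  rewrite integral_itv_bndoo/=; last first.
    apply/measurable_EFinP/measurable_funTS.
    exact: continuous_measurable_fun.
  rewrite [RHS]integral_mkcond; apply: eq_integral => y _.
  rewrite !patchE; congr (if _ then _ else _).
  apply/idP/idP => /set_mem; first by case=> _ /= y0; exact/mem_set.
  by move=> y0; apply/mem_set; split => //; exact: set_mem.
pose G := fun y => v (x, y) * eta y.
have dG y : is_derive y (1 : R) G (F (x, y)).
  have ? := is_derive_slice _ _ _ (dv (x, y)).2.
  have ? := deta y.
  apply: is_derive_eq; rewrite /F /GRing.scale/= [RHS]addrC; congr (_ + _).
  exact: mulrC.
rewrite (@continuous_FTC2 _ (fun y => F (x, y)) G)//.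
- exact: continuous_subspaceT.
- have cG : continuous G.
    move=> y; apply: differentiable_continuous; apply/derivable1_diffP.
    exact: (@ex_derive _ _ _ _ _ _ _ (dG y)).
  split => [y _||].
  + exact: (@ex_derive _ _ _ _ _ _ _ (dG y)).
  + exact/cvg_at_right_filter/cG.
  + exact/cvg_at_left_filter/cG.
- by move=> y _; rewrite derive1E; exact: (@derive_val _ _ _ _ _ _ _ (dG y)).
Qed.
End Strip.

(** * Increment of a Sobolev function across the rectangle *)

Section WeakIncrement.
Context {R : realType}.
Notation mu1 := (@lebesgue_measure R).
Notation mu2 := (mu1 \x mu1)%E.

Lemma in_L2S d (T : measurableType d) (mu : {measure set T -> \bar R})
    (S D : set T) (f : T -> R) : measurable S -> measurable D -> S `<=` D ->
  in_L2 mu D f -> in_L2 mu S f.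
Proof.
move=> mS mD SD [mf foo]; split; first exact: measurable_funS mf.
apply: le_lt_trans foo; apply: ge0_subset_integral => //.
  by apply/measurable_EFinP; exact: measurable_funX.
by move=> x _; rewrite lee_fin sqr_ge0.
Qed.

Lemma L2_cvgS d (T : measurableType d) (mu : {measure set T -> \bar R})
    (S D : set T) (f_ : nat -> T -> R) (f : T -> R) :
  measurable S -> measurable D -> S `<=` D ->
  (forall n, measurable_fun D (f_ n)) -> measurable_fun D f ->
  L2_cvg mu D f_ f -> L2_cvg mu S f_ f.
Proof.
move=> mS mD SD mf_ mf f_f.
apply: squeeze_cvge (cvg_cst 0%E) f_f; apply: nearW => n; apply/andP; split.
  by apply: integral_ge0 => x _; rewrite lee_fin sqr_ge0.
apply: ge0_subset_integral => //.
  by apply/measurable_EFinP/measurable_funX/measurable_funB.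
by move=> x _; rewrite lee_fin sqr_ge0.
Qed.

(** The boundary terms are left as the limit [L] along the approximating sequence:
    a cutoff that vanishes on one side of the strip then needs a trace on the other
    side only, and one that vanishes on both sides needs none. *)
Lemma strip_weak_FTC (eps g : R) (D : set (R * R)) (v_ : nat -> R * R -> R)
    (u : R * R -> R) (du : R * R -> R * R) (eta eta' : R -> R) (L : R) :
  0 < eps -> 0 < g -> measurable D -> strip eps g `<=` D ->
  in_L2 mu2 D u -> in_L2 mu2 D (snd \o du) ->
  (forall n, C1_per eps (v_ n)) -> H1_cvg D v_ u du ->
  (forall y : R, is_derive y (1 : R) eta (eta' y)) -> continuous eta' ->
  \int[mu1]_(x in `]0, eps[) (v_ n (x, g) * eta g - v_ n (x, 0) * eta 0)
    @[n --> \oo] --> L ->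
  \int[mu2]_(z in strip eps g) ((du z).2 * eta z.2) +
  \int[mu2]_(z in strip eps g) (u z * eta' z.2) = L.
Proof.
move=> eps0 g0 mD SD u2 du2 v_C [v_u _ v_du] deta ceta' bL.
have mS := measurable_strip eps g.
have ceta : continuous eta.
  move=> y; apply: differentiable_continuous; apply/derivable1_diffP.
  exact: (@ex_derive _ _ _ _ _ _ _ (deta y)).
have snd2 (h : R -> R) : continuous h ->
    in_L2 mu2 (strip eps g) (fun z => h z.2).
  move=> ch; apply: continuous_in_L2_strip => //.
  by move=> z; apply: continuous_comp; [exact: cvg_snd|exact: ch].
have mv n E : measurable_fun E (v_ n).
  by case: (v_C n) => _ ? _ _ _; exact: continuous_measurable_plane.
have mdv n E : measurable_fun E ('D_e2 (v_ n)).
  by case: (v_C n) => _ _ _ _ ?; exact: continuous_measurable_plane.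
have c1 : \int[mu2]_(z in strip eps g) ('D_e2 (v_ n) z * eta z.2)
    @[n --> \oo] --> \int[mu2]_(z in strip eps g) ((du z).2 * eta z.2).
  apply: (@L2_cvg_Rintegral _ _ _ mu2 _ mS _ (snd \o du)).
  - by move=> n; exact: mdv.
  - exact: (in_L2S _ _ mu2 _ _ _ mS mD SD du2).
  - exact: snd2.
  - by apply: (L2_cvgS _ _ mu2 _ D) v_du => // [n|]; [exact: mdv|exact: du2.1].
have c2 : \int[mu2]_(z in strip eps g) (v_ n z * eta' z.2)
    @[n --> \oo] --> \int[mu2]_(z in strip eps g) (u z * eta' z.2).
  apply: (@L2_cvg_Rintegral _ _ _ mu2 _ mS).
  - by move=> n; exact: mv.
  - exact: (in_L2S _ _ mu2 _ _ _ mS mD SD u2).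
  - exact: snd2.
  - by apply: (L2_cvgS _ _ mu2 _ D) v_u => // [n|]; [exact: mv|exact: u2.1].
rewrite -(cvg_lim (@Rhausdorff R) bL); apply/esym/(cvg_lim (@Rhausdorff R)).
rewrite (_ : (fun n => _) = (fun n =>
    \int[mu2]_(z in strip eps g) ('D_e2 (v_ n) z * eta z.2) +
    \int[mu2]_(z in strip eps g) (v_ n z * eta' z.2))); first exact: cvgD.
apply/funext => n; rewrite -(@strip_FTC _ _ _ _ _ eta')//.
case: (v_C n) => _ cv _ _ cdv.
rewrite RintegralD//; apply: in_L2_integrableM => //; try exact: snd2;
  exact: continuous_in_L2_strip.
Qed.

Lemma trace_integral_cvg (eps : R) (f_ : nat -> R -> R) (tau : R -> R) (c : R) :
  0 < eps -> (forall n, continuous (f_ n)) -> in_L2 mu1 `]0, eps[ tau ->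
  L2_cvg mu1 `]0, eps[ f_ tau ->
  \int[mu1]_(x in `]0, eps[) (f_ n x * c) @[n --> \oo] -->
  (\int[mu1]_(x in `]0, eps[) tau x) * c.
Proof.
move=> eps0 cf tau2 f_tau.
have one2 : in_L2 mu1 `]0, eps[ (cst (1 : R)).
  apply: (@in_L2_bounded _ _ _ _ _ _ _ 1) => //.
  - by have := ltry eps; rewrite -(lebesgue_measure_itv0 _ (ltW eps0)).
  - by move=> x _; rewrite normr1.
have mf n : measurable_fun `]0, eps[ (f_ n).
  by apply: measurable_funTS; exact: continuous_measurable_fun.
have taui : mu1.-integrable `]0, eps[ (EFin \o tau).
  have := in_L2_integrableM _ _ _ mu1 _ (measurable_itv _) _ _ tau2 one2.
  by apply: eq_integrable => // x _ /=; rewrite mulr1.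
rewrite (_ : (fun n => _) = fun n =>
    (\int[mu1]_(x in `]0, eps[) (f_ n x * cst 1 x)) * c).
  apply: cvgMr_tmp; rewrite (_ : \int[mu1]_(x in _) tau x =
      \int[mu1]_(x in `]0, eps[) (tau x * cst 1 x)).
    exact: (L2_cvg_Rintegral _ _ _ mu1 _ (measurable_itv _) _ _ _ mf tau2 one2).
  by apply: eq_Rintegral => x _; rewrite mulr1.
apply/funext => n; rewrite -RintegralZr//.
  by apply: eq_Rintegral => x _ /=; rewrite mulr1.
apply: (@integrableS _ _ _ mu1 `[0, eps]) => //; first exact: subset_itv_oo_cc.
rewrite (_ : _ \o _ = EFin \o f_ n); last by apply/funext => x /=; rewrite mulr1.
apply: continuous_compact_integrable; first exact: segment_compact.
exact: continuous_subspaceT.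
Qed.

Lemma is_derive_affine_pow (a b : R) k (y : R) :
  is_derive y (1 : R) (fun y => (a * y + b) ^+ k.+1)
    (k.+1%:R * a * (a * y + b) ^+ k).
Proof.
have daff : is_derive y (1 : R) (fun y => a * y + b) a.
  rewrite (_ : (fun _ => _) = a *: id + cst b); last exact/funext.
  by apply: is_derive_eq; rewrite addr0 /GRing.scale/= mulr1.
rewrite (_ : (fun y => _ ^+ _) = (fun y => a * y + b) ^+ k.+1).
  by apply: is_derive_eq; rewrite /GRing.scale/= mulrAC.
by apply/funext => x; rewrite exprfctE.
Qed.

Lemma continuous_affine_pow (a b c : R) k :
  continuous (fun y => c * (a * y + b) ^+ k).
Proof.
move=> y; apply: cvgMl_tmp.
apply: (@continuous_comp _ _ _ (fun y => a * y + b) (fun x => x ^+ k)).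
  by apply: cvgD; [apply: cvgMl_tmp; exact: cvg_id|exact: cvg_cst].
exact: exprn_continuous.
Qed.

Lemma continuous_snd_in_L2_strip (eps g : R) (h : R -> R) : 0 < eps -> 0 < g ->
  continuous h -> in_L2 mu2 (strip eps g) (fun z => h z.2).
Proof.
move=> eps0 g0 ch; apply: continuous_in_L2_strip => // z.
by apply: continuous_comp; [exact: cvg_snd|exact: ch].
Qed.

Lemma in_L2_strip_integrable (eps g : R) (f : R * R -> R) : 0 < eps -> 0 < g ->
  in_L2 mu2 (strip eps g) f -> mu2.-integrable (strip eps g) (EFin \o f).
Proof.
move=> eps0 g0 f2; have mS := measurable_strip eps g.
have c1 : continuous (cst 1 : R -> R) by move=> y; exact: cvg_cst.
have := in_L2_integrableM _ _ _ mu2 _ mS _ _ f2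
  (continuous_snd_in_L2_strip _ _ _ eps0 g0 c1).
by apply: (@eq_integrable _ _ _ mu2 _ mS) => z _ /=; rewrite mulr1.
Qed.

(** Dominated convergence: a cutoff with values in [0, 1[ has vanishing powers. *)
Lemma strip_pow_cvg0 (eps g : R) (f : R * R -> R) (w : R -> R) :
  0 < eps -> 0 < g -> in_L2 mu2 (strip eps g) f -> continuous w ->
  (forall y, 0 < y < g -> 0 <= w y < 1) ->
  \int[mu2]_(z in strip eps g) (f z * w z.2 ^+ k) @[k --> \oo] --> (0 : R).
Proof.
move=> eps0 g0 f2 cw w01; have mS := measurable_strip eps g.
have fi := in_L2_strip_integrable _ _ _ eps0 g0 f2.
have w01z z : strip eps g z -> 0 <= w z.2 < 1.
  by case=> _ /=; rewrite in_itv/= => /w01.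
have mw k : measurable_fun (strip eps g) (fun z => w z.2 ^+ k).
  apply: measurable_funX.
  by case: (continuous_snd_in_L2_strip _ _ _ eps0 g0 cw).
suff /fine_cvgP[] : (\int[mu2]_(z in strip eps g) (f z * w z.2 ^+ k)%:E)%E
    @[k --> \oo] --> (0 : R)%:E by [].
rewrite -[X in _ --> X](integral0 mu2 (strip eps g)).
apply: (@dominated_cvg _ _ _ mu2 _ mS (fun k z => (f z * w z.2 ^+ k)%:E) _
  (fun z => `|f z|%:E)) => //.
- by move=> k; apply/measurable_EFinP; apply: measurable_funM; [case: f2|exact: mw].
- move=> z Sz /=; apply: cvg_EFin; first exact: nearW.
  rewrite -[X in _ --> X](mulr0 (f z)).
  apply: cvgMl_tmp; apply: cvg_expr.
  by case/andP: (w01z _ Sz) => w0 w1; rewrite ger0_norm.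
- exact: (integrable_norm fi).
- move=> k z Sz; rewrite /= lee_fin normrM ler_piMr//.
  by case/andP: (w01z _ Sz) => w0 w1; rewrite ger0_norm ?exprn_ge0// exprn_ile1// ltW.
Qed.

(** The three weak gradients at hand, [du] and one for each trace, are tested
    against their own term of the partition [1 = h k + c' k + c k], where [h k]
    vanishes on both sides of the strip while [c' k] and [c k] concentrate on the
    bottom and on the top.  The terms in [u] cancel because the partition sums to a
    constant, and only [du] survives as [k] tends to infinity. *)
Lemma strip_increment (eps g : R) (D : set (R * R)) (u : R * R -> R)
    (du : R * R -> R * R) (tau0 tau1 : R -> R) :
  0 < eps -> 0 < g -> measurable D -> strip eps g `<=` D ->
  H1_per eps D u du ->
  trace_on eps D (cst 0) u tau0 -> trace_on eps D (cst g) u tau1 ->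
  \int[mu2]_(z in strip eps g) (du z).2 =
  \int[mu1]_(x in `]0, eps[) tau1 x - \int[mu1]_(x in `]0, eps[) tau0 x.
Proof.
move=> eps0 g0 mD SD Hu [tau02 [du0 Hu0 [v0 [v0C v0cvg v0tau]]]]
  [tau12 [du1 Hu1 [v1 [v1C v1cvg v1tau]]]].
case: (Hu) => u2 _ du2 [v vC vcvg].
case: Hu0 => _ _ du02 _; case: Hu1 => _ _ du12 _.
pose c k y := (g^-1 * y + 0) ^+ k.+1; pose c' k y := (- g^-1 * y + 1) ^+ k.+1.
pose dc k y := k.+1%:R * g^-1 * (g^-1 * y + 0) ^+ k.
pose dc' k y := k.+1%:R * - g^-1 * (- g^-1 * y + 1) ^+ k.
pose h k y := 1 - c k y - c' k y.
have Dc k (y : R) : is_derive y (1 : R) (c k) (dc k y).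
  exact: is_derive_affine_pow.
have Dc' k (y : R) : is_derive y (1 : R) (c' k) (dc' k y).
  exact: is_derive_affine_pow.
have Dh k (y : R) : is_derive y (1 : R) (h k) (- dc k y - dc' k y).
  have ? := Dc k y; have ? := Dc' k y.
  rewrite (_ : h k = cst 1 - c k - c' k); last exact/funext.
  by apply: is_derive_eq; rewrite sub0r.
have cc k : continuous (c k).
  have := continuous_affine_pow g^-1 0 1 k.+1.
  by under eq_fun do rewrite mul1r.
have cc' k : continuous (c' k).
  have := continuous_affine_pow (- g^-1) 1 1 k.+1.
  by under eq_fun do rewrite mul1r.
have cdc k : continuous (dc k) by exact: continuous_affine_pow.
have cdc' k : continuous (dc' k) by exact: continuous_affine_pow.
have cdh k : continuous (fun y => - dc k y - dc' k y).
  by move=> y; apply: cvgB; [apply: cvgN; exact: cdc|exact: cdc'].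
have c_g k : c k g = 1 by rewrite /c mulVf ?gt_eqF// addr0 expr1n.
have c_0 k : c k 0 = 0 by rewrite /c mulr0 addr0 expr0n.
have c'_g k : c' k g = 0 by rewrite /c' mulNr mulVf ?gt_eqF// addNr expr0n.
have c'_0 k : c' k 0 = 1 by rewrite /c' mulr0 add0r expr1n.
set S := strip eps g.
have mS := measurable_strip eps g.
have toS f : in_L2 mu2 D f -> in_L2 mu2 S f.
  by move=> f2; exact: (in_L2S _ _ mu2 _ _ _ mS mD SD f2).
have intM f (p : R -> R) : in_L2 mu2 D f -> continuous p ->
    mu2.-integrable S (EFin \o (fun z => f z * p z.2)).
  move=> f2 cp; apply: in_L2_integrableM => //; first exact: toS.
  exact: continuous_snd_in_L2_strip.
have cslice (v' : nat -> R * R -> R) (C : forall n, C1_per eps (v' n)) y n :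
    continuous (fun x => v' n (x, y)).
  move=> x; case: (C n) => _ cv _ _ _.
  apply: (@continuous_comp _ _ _ (fun x => (x, y)) (v' n)); last exact: cv.
  exact: cvg_pair cvg_id (cvg_cst _).
set I1 := \int[mu1]_(x in _) tau1 x; set I0 := \int[mu1]_(x in _) tau0 x.
have E k : \int[mu2]_(z in S) ((du z).2 * h k z.2) +
    \int[mu2]_(z in S) (u z * (- dc k z.2 - dc' k z.2)) = 0.
  apply: (@strip_weak_FTC eps g D v u du (h k) (fun y => - dc k y - dc' k y) 0)
    => //.
  rewrite (_ : (fun n => _) = cst 0); first exact: cvg_cst.
  apply/funext => n; rewrite /h c_g c_0 c'_g c'_0 !subr0 !subrr.
  under eq_Rintegral do rewrite !mulr0 subr0.
  by rewrite Rintegral_cst ?mul0r.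
have E1 k : \int[mu2]_(z in S) ((du1 z).2 * c k z.2) +
    \int[mu2]_(z in S) (u z * dc k z.2) = I1.
  apply: (@strip_weak_FTC eps g D v1 u du1 (c k) (dc k) I1) => //.
  rewrite c_g c_0 -[I1]mulr1.
  under eq_fun do under eq_Rintegral do rewrite mulr0 subr0.
  exact: (trace_integral_cvg _ _ _ _ eps0 (cslice v1 v1C g) tau12 v1tau).
have E0 k : \int[mu2]_(z in S) ((du0 z).2 * c' k z.2) +
    \int[mu2]_(z in S) (u z * dc' k z.2) = - I0.
  apply: (@strip_weak_FTC eps g D v0 u du0 (c' k) (dc' k) (- I0)) => //.
  rewrite c'_g c'_0 -mulrN1.
  under eq_fun do under eq_Rintegral do rewrite mulr0 sub0r -mulrN.
  exact: (trace_integral_cvg _ _ _ _ eps0 (cslice v0 v0C 0) tau02 v0tau).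
have sum0 k : \int[mu2]_(z in S) (u z * (- dc k z.2 - dc' k z.2)) =
    - (\int[mu2]_(z in S) (u z * dc k z.2) + \int[mu2]_(z in S) (u z * dc' k z.2)).
  rewrite -mulN1r.
  rewrite -RintegralD//; [|exact: intM|exact: intM].
  rewrite -RintegralZl//; first by apply: eq_Rintegral => z _; ring.
  have := @integrableD _ _ _ mu2 S mS _ _
    (intM _ _ u2 (cdc k)) (intM _ _ u2 (cdc' k)).
  by apply: eq_integrable => // z _ /=; rewrite EFinD.
have hE k : \int[mu2]_(z in S) ((du z).2 * h k z.2) =
    \int[mu2]_(z in S) (du z).2 - \int[mu2]_(z in S) ((du z).2 * c k z.2)
    - \int[mu2]_(z in S) ((du z).2 * c' k z.2).
  have i0 := in_L2_strip_integrable _ _ _ eps0 g0 (toS _ du2).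
  have i1 := intM _ _ du2 (cc k); have i2 := intM _ _ du2 (cc' k).
  rewrite -!RintegralB//; last exact: (@integrableB _ _ _ mu2 S mS _ _ i0 i1).
  by apply: eq_Rintegral => z _; rewrite /h; ring.
have lim1 (f : R * R -> R) : in_L2 mu2 D f ->
    \int[mu2]_(z in S) (f z * c k z.2) @[k --> \oo] --> (0 : R).
  move=> /toS f2.
  have := strip_pow_cvg0 _ _ _ (fun y => g^-1 * y + 0) eps0 g0 f2.
  rewrite -cvg_shiftS; apply.
    have := continuous_affine_pow g^-1 0 1 1.
    by under eq_fun do rewrite mul1r expr1.
  move=> y /andP[y0 yg]; rewrite addr0 mulrC ltr_pdivrMr// mul1r yg andbT.
  by rewrite divr_ge0// ltW.
have lim0 (f : R * R -> R) : in_L2 mu2 D f ->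
    \int[mu2]_(z in S) (f z * c' k z.2) @[k --> \oo] --> (0 : R).
  move=> /toS f2.
  have := strip_pow_cvg0 _ _ _ (fun y => - g^-1 * y + 1) eps0 g0 f2.
  rewrite -cvg_shiftS; apply.
    have := continuous_affine_pow (- g^-1) 1 1 1.
    by under eq_fun do rewrite mul1r expr1.
  move=> y /andP[y0 yg]; have yg1 : y / g < 1 by rewrite ltr_pdivrMr// mul1r.
  have yg0 : 0 < y / g by rewrite divr_gt0.
  by rewrite mulNr mulrC; apply/andP; split; lra.
have c1 := lim1 _ du2; have c2 := lim0 _ du2.
have c3 := lim1 _ du12; have c4 := lim0 _ du02.
have L : (\int[mu2]_(z in S) ((du z).2 * c k z.2) +
    \int[mu2]_(z in S) ((du z).2 * c' k z.2)) -
    (\int[mu2]_(z in S) ((du1 z).2 * c k z.2) +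
     \int[mu2]_(z in S) ((du0 z).2 * c' k z.2)) @[k --> \oo] --> (0 : R).
  rewrite -[X in _ --> X](_ : (0 + 0) - (0 + 0) = 0 :> R).
    by apply: cvgB; exact: cvgD.
  by rewrite !addr0 subr0.
move: L; rewrite (_ : (fun k => _) =
    cst (\int[mu2]_(z in S) (du z).2 - (I1 - I0))); last first.
  have solve (H X a b a1 b0 p q x i1 i0 : R) : H + x = 0 -> a1 + p = i1 ->
      b0 + q = - i0 -> x = - (p + q) -> H = X - a - b ->
      (a + b) - (a1 + b0) = X - (i1 - i0) by lra.
  apply/funext => k /=.
  exact: solve (E k) (E1 k) (E0 k) (sum0 k) (hE k).
move=> /(cvg_lim (@Rhausdorff R)); rewrite lim_cst; last exact: Rhausdorff.
by move/eqP; rewrite subr_eq0 => /eqP.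
Qed.

End WeakIncrement.

(** * Subtracting a shear flow *)

Lemma eq_L2_cvg d (T : measurableType d) (R : realType)
    (mu : set T -> \bar R) (D : set T) (f_ f'_ : nat -> T -> R) (f f' : T -> R) :
  (forall n x, f'_ n x - f' x = f_ n x - f x) ->
  L2_cvg mu D f_ f -> L2_cvg mu D f'_ f'.
Proof.
move=> E; rewrite /L2_cvg; suff -> : (fun n => \int[mu]_(z in D)
    ((f'_ n z - f' z) ^+ 2)%:E)%E =
  (fun n => \int[mu]_(z in D) ((f_ n z - f z) ^+ 2)%:E)%E by [].
by apply/funext => n; congr (integral mu D); apply/funext => z; rewrite E.
Qed.

Section Competitor.
Context {R : realType}.
Notation mu1 := (@lebesgue_measure R).
Notation mu2 := (mu1 \x mu1)%E.
Variables (eps a g : R) (D : set (R * R)).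
Hypotheses (eps0 : 0 < eps) (ag : a < g) (mD : measurable D).
Hypothesis D_box : D `<=` `]0, eps[ `*` `]a, g[.

Lemma box_measure : (mu2 D <= (eps * (g - a))%:E)%E.
Proof.
apply: (@le_trans _ _ (mu2 (`]0, eps[ `*` `]a, g[))).
  by apply: le_measure; rewrite ?inE//; exact: measurableX.
rewrite product_measure1E//.
have -> : (eps * (g - a))%:E = (eps%:E * (g - a)%:E)%E by [].
have <- : mu1 (`]a, g[%classic : set R) = (g - a)%:E.
  by rewrite lebesgue_measure_itv/= lte_fin ag.
by rewrite -(lebesgue_measure_itv0 _ (ltW eps0)).
Qed.

Lemma box_lty : (mu2 D < +oo)%E.
Proof. by apply: le_lt_trans box_measure _; exact: ltry. Qed.

Lemma shear_in_L2 (w : R -> R) : continuous w -> in_L2 mu2 D (fun z => w z.2).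
Proof.
move=> cw.
have := continuous_compact (continuous_subspaceT cw) (@segment_compact _ a g).
move=> /compact_bounded[K [_ /(_ (K + 1))]].
rewrite ltrDl ltr01 => /(_ isT) wK.
apply: (@in_L2_bounded _ _ _ mu2 _ mD _ (K + 1) box_lty).
  apply: continuous_measurable_plane => z.
  by apply: continuous_comp; [exact: cvg_snd|exact: cw].
move=> z /D_box[_ zag]; apply: wK; exists z.2 => //.
exact: subset_itv_oo_cc.
Qed.

Variables (v dv : R -> R).
Hypothesis v_dv : forall y : R, is_derive y (1 : R) v (dv y).
Hypothesis cdv : continuous dv.

Let V : R * R -> R := fun z => v z.2.

Let cv : continuous v.
Proof.
move=> y; apply: differentiable_continuous; apply/derivable1_diffP.
exact: (@ex_derive _ _ _ _ _ _ _ (v_dv y)).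
Qed.

Lemma is_derive_shear1 z : is_derive z e1 V 0.
Proof.
have E : (fun h : R => h^-1 *: (V (h *: e1 + z) - V z)) = cst 0.
  apply/funext => h; rewrite /V /e1/= scaler0 add0r subrr scaler0.
  by [].
split; first by rewrite /derivable E; exact: is_cvg_cst.
by rewrite /derive E lim_cst.
Qed.

Lemma is_derive_shear2 z : is_derive z e2 V (dv z.2).
Proof.
have E : (fun h : R => h^-1 *: (V (h *: e2 + z) - V z)) =
         (fun h : R => h^-1 *: (v (h *: 1 + z.2) - v z.2)) by [].
have [d1 d2] := v_dv z.2.
by split; [rewrite /derivable E|rewrite /derive E].
Qed.

Lemma shear_C1_per : C1_per eps V.
Proof.
have d1 : 'D_e1 V = cst 0.
  by apply/funext => z; exact: (@derive_val _ _ _ _ _ _ _ (is_derive_shear1 z)).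
have d2 : 'D_e2 V = fun z => dv z.2.
  by apply/funext => z; exact: (@derive_val _ _ _ _ _ _ _ (is_derive_shear2 z)).
split => //.
- by move=> z; apply: continuous_comp; [exact: cvg_snd|exact: cv].
- move=> z; split.
    exact: (@ex_derive _ _ _ _ _ _ _ (is_derive_shear1 z)).
  exact: (@ex_derive _ _ _ _ _ _ _ (is_derive_shear2 z)).
- by rewrite d1 => z; exact: cvg_cst.
- by rewrite d2 => z; apply: continuous_comp; [exact: cvg_snd|exact: cdv].
Qed.

Lemma C1_perB (f h : R * R -> R) : C1_per eps f -> C1_per eps h ->
  C1_per eps (f \- h).
Proof.
move=> [fp cf df cf1 cf2] [hp ch dh ch1 ch2].
have d1 : 'D_e1 (f \- h) = 'D_e1 f \- 'D_e1 h.
  by apply/funext => z; rewrite deriveB//; [exact: (df z).1|exact: (dh z).1].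
have d2 : 'D_e2 (f \- h) = 'D_e2 f \- 'D_e2 h.
  by apply/funext => z; rewrite deriveB//; [exact: (df z).2|exact: (dh z).2].
split.
- by move=> z /=; rewrite fp hp.
- by move=> z; apply: continuousB; [exact: cf|exact: ch].
- move=> z; have [? ?] := df z; have [? ?] := dh z.
  by split; exact: derivableB.
- by rewrite d1 => z; apply: continuousB; [exact: cf1|exact: ch1].
- by rewrite d2 => z; apply: continuousB; [exact: cf2|exact: ch2].
Qed.

(** The same [V] is subtracted from the approximating sequence and from its limit,
    so that the differences whose norms tend to [0] do not change. *)
Lemma H1_cvg_subshear (v_ : nat -> R * R -> R) (u : R * R -> R)
    (du : R * R -> R * R) :
  (forall n, C1_per eps (v_ n)) -> H1_cvg D v_ u du ->
  H1_cvg D (fun n => v_ n \- V) (u \- V) (fun z => ((du z).1, (du z).2 - dv z.2)).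
Proof.
move=> vC [c0 c1 c2].
have d1 n : 'D_e1 (v_ n \- V) = 'D_e1 (v_ n).
  apply/funext => z; case: (vC n) => _ _ /(_ z)[dn _] _ _.
  have [d1 d2] := is_derive_shear1 z.
  by rewrite deriveB// d2 subr0.
have d2 n : 'D_e2 (v_ n \- V) = 'D_e2 (v_ n) \- (fun z => dv z.2).
  apply/funext => z; case: (vC n) => _ _ /(_ z)[_ dn] _ _.
  have [d1' d2'] := is_derive_shear2 z.
  by rewrite deriveB// d2'.
split.
- by apply: eq_L2_cvg c0 => n z /=; ring.
- apply: eq_L2_cvg c1 => n z; congr (_ - _).
  exact: (congr1 (@^~ z) (d1 n)).
- apply: eq_L2_cvg c2 => n z.
  transitivity (('D_e2 (v_ n) z - dv z.2) - ((du z).2 - dv z.2)).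
    by congr (_ - _); exact: (congr1 (@^~ z) (d2 n)).
  by rewrite /=; ring.
Qed.

Lemma H1_per_subshear (u : R * R -> R) (du : R * R -> R * R) :
  H1_per eps D u du ->
  H1_per eps D (u \- V) (fun z => ((du z).1, (du z).2 - dv z.2)).
Proof.
move=> [u2 du12 du22 [v_ vC vcvg]]; split => //.
- by apply: in_L2B => //; exact: shear_in_L2.
- apply: (@in_L2B _ _ _ mu2 _ mD (snd \o du)) => //; exact: shear_in_L2.
- exists (fun n => v_ n \- V); last exact: H1_cvg_subshear.
  by move=> n; apply: C1_perB => //; exact: shear_C1_per.
Qed.

Lemma trace_on_subshear (h : R -> R) (u : R * R -> R) :
  trace_on eps D h u (v \o h) -> trace_on eps D h (u \- V) (cst 0).
Proof.
move=> [t2 [du Hu [v_ [vC vcvg vtau]]]]; split.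
  split; first exact: measurable_cst.
  by under eq_integral do rewrite /= expr0n; rewrite integral0 ltry.
exists (fun z => ((du z).1, (du z).2 - dv z.2)); first exact: H1_per_subshear.
exists (fun n => v_ n \- V); split.
- by move=> n; apply: C1_perB => //; exact: shear_C1_per.
- exact: H1_cvg_subshear.
- by apply: eq_L2_cvg vtau => n x; rewrite /V /=; ring.
Qed.

End Competitor.

(** * The rough domain and the energy estimate *)

Section RoughDomain.
Context {R : realType}.
Notation mu1 := (@lebesgue_measure R).
Notation mu2 := (mu1 \x mu1)%E.
Variables (phi : R -> R) (eps g : R).
Hypotheses (phi_bounded : bounded_fun phi).
Hypotheses (phi_lipschitz : exists k : R, k.-lipschitz phi).
Hypotheses (phi_ge0 : forall x, 0 <= phi x).
Hypotheses (eps0 : 0 < eps) (g0 : 0 < g).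

Let h := rough_bottom phi eps.
Let M := eps * sup_norm phi.
Let Omega := Omega_mic phi eps g.

Lemma le_sup_norm x : phi x <= sup_norm phi.
Proof.
rewrite -[leLHS]ger0_norm//; apply: ub_le_sup; last by exists x.
have [K [_ /(_ (K + 1))]] := phi_bounded.
rewrite ltrDl ltr01 => /(_ isT) phiK.
by exists (K + 1) => _ [y _ <-]; exact: phiK.
Qed.

Lemma rough_bottom_le0 x : h x <= 0.
Proof. by rewrite /h /rough_bottom subr_le0 ler_pM2l// le_sup_norm. Qed.

Lemma rough_bottom_geN x : - M <= h x.
Proof. by rewrite /h /rough_bottom -[leLHS]add0r lerD2r mulr_ge0// ltW. Qed.

Lemma sup_norm_ge0 : 0 <= sup_norm phi.
Proof. exact: le_trans (phi_ge0 0) (le_sup_norm 0). Qed.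

Lemma rough_bottom_continuous : continuous h.
Proof.
have [k klip] := phi_lipschitz.
have cphi : continuous phi.
  move=> x; apply/cvgrPdist_le => e e0.
  near=> y.
  have := klip (x, y) (conj I I) => /= kxy.
  apply: le_trans kxy _.
  apply: (@le_trans _ _ ((`|k| + 1) * `|x - y|)).
    by rewrite ler_wpM2r// (le_trans (ler_norm k))// lerDl.
  rewrite -ler_pdivlMl ?ltr_wpDl//; near: y.
  by apply: cvgr_dist_le; [exact: cvg_id|rewrite mulr_gt0// invr_gt0 ltr_wpDl].
have cscale : continuous (fun x : R => x / eps).
  by move=> x; apply: cvgMr_tmp; exact: cvg_id.
have cphi_scale : continuous (phi \o (fun x : R => x / eps)).
  by move=> x; apply: continuous_comp; [exact: cscale|exact: cphi].
move=> x; apply: cvgB; last exact: cvg_cst.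
by apply: cvgMl_tmp; exact: cphi_scale.
Unshelve. all: by end_near. Qed.

Lemma measurable_Omega : measurable Omega.
Proof.
have -> : Omega = (fst @^-1` `]0, eps[) `&`
    ((fun z : R * R => z.2 - h z.1) @^-1` `]0, +oo[) `&` (snd @^-1` `]-oo, g[).
  apply/seteqP; split => -[x y] /=; rewrite !in_itv/= ?andbT subr_gt0.
    by move=> [x0 /andP[hy yg]].
  by move=> [[x0 hy] yg]; split => //; apply/andP.
have pre (f : R * R -> R) (A : set R) : continuous f -> measurable A ->
    measurable (f @^-1` A).
  move=> cf mA; rewrite -[X in measurable X]setTI.
  exact: continuous_measurable_plane.
apply: measurableI; first apply: measurableI; apply: pre => //.
- by move=> z; exact: cvg_fst.
- move=> z; apply: cvgB; first exact: cvg_snd.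
  by apply: continuous_comp; [exact: cvg_fst|exact: rough_bottom_continuous].
- by move=> z; exact: cvg_snd.
Qed.

Lemma Omega_box : Omega `<=` `]0, eps[ `*` `](- M), g[.
Proof.
move=> [x y] [/= x0 /andP[hy yg]]; split; rewrite /= in_itv//= yg andbT.
exact: le_lt_trans (rough_bottom_geN x) hy.
Qed.

Lemma strip_Omega : strip eps g `<=` Omega.
Proof.
move=> [x y] [] /=; rewrite !in_itv/= => x0 /andP[y0 yg]; split => //=.
by rewrite yg andbT; exact: le_lt_trans (rough_bottom_le0 x) y0.
Qed.

Let Mg : - M < g.
Proof.
by apply: le_lt_trans g0; rewrite oppr_le0 mulr_ge0 ?sup_norm_ge0// ltW.
Qed.

Variables (v dv : R -> R).
Hypothesis v_dv : forall y : R, is_derive y (1 : R) v (dv y).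
Hypothesis cdv : continuous dv.
Variables (u : R * R -> R * R) (p : R * R -> R).
Hypothesis u_bottom1 : trace_on eps Omega h (fst \o u) (v \o h).
Hypothesis u_bottom2 : trace_on eps Omega h (snd \o u) (cst 0).
Hypothesis u_top1 : trace_on eps Omega (cst g) (fst \o u) (cst (v g)).
Hypothesis u_top2 : trace_on eps Omega (cst g) (snd \o u) (cst 0).

Let dv2 : in_L2 mu2 Omega (fun z => dv z.2).
Proof.
exact: (shear_in_L2 _ _ _ _ eps0 Mg measurable_Omega Omega_box _ cdv).
Qed.

(** With [w] the derivative of the shear profile, the weak formulation tested with
    [u] minus the shear flow says that the energy density of [u] minus
    [(du1 z).2 * w] integrates to [0], and
    [(du1 z).2 * w <= ((du1 z).2 ^+ 2 + w ^+ 2) / 2]. *)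
Lemma shear_energy (du1 du2 : R * R -> R * R) :
  in_L2 mu2 Omega p -> vH1_per phi eps g u du1 du2 ->
  {ae mu2, forall z, Omega z -> (du1 z).1 + (du2 z).2 = 0} ->
  (forall (psi dpsi1 dpsi2 : R * R -> R * R),
        vH1_per phi eps g psi dpsi1 dpsi2 ->
        vtrace_on eps Omega h psi (cst 0) ->
        vtrace_on eps Omega (cst g) psi (cst 0) ->
        (\int[mu2]_(z in Omega)
           ((du1 z).1 * (dpsi1 z).1 + (du1 z).2 * (dpsi1 z).2
            + (du2 z).1 * (dpsi2 z).1 + (du2 z).2 * (dpsi2 z).2
            - p z * ((dpsi1 z).1 + (dpsi2 z).2))%:E = 0)%E) ->
  \int[mu2]_(z in Omega) ((du1 z).2 ^+ 2) <= \int[mu2]_(z in Omega) (dv z.2 ^+ 2).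
Proof.
move=> p2 [H1 H2] divu weak.
have mO := measurable_Omega.
pose psi z := ((u z).1 - v z.2, (u z).2).
pose dpsi1 z := ((du1 z).1, (du1 z).2 - dv z.2).
have psiH : vH1_per phi eps g psi dpsi1 du2.
  split => //.
  exact: (H1_per_subshear _ _ _ _ eps0 Mg mO Omega_box _ _ v_dv cdv).
have psi_bottom : vtrace_on eps Omega h psi (cst 0).
  split => //.
  exact: (trace_on_subshear _ _ _ _ eps0 Mg mO Omega_box _ _ v_dv cdv).
have psi_top : vtrace_on eps Omega (cst g) psi (cst 0).
  split => //.
  exact: (trace_on_subshear _ _ _ _ eps0 Mg mO Omega_box _ _ v_dv cdv).
have := weak psi dpsi1 du2 psiH psi_bottom psi_top.
have [[_ a2 b2 _] [_ c2 d2 _]] := (H1, H2).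
pose a z := (du1 z).1; pose b z := (du1 z).2; pose w (z : R * R) := dv z.2.
pose c z := (du2 z).1; pose d z := (du2 z).2.
pose G z := a z * a z + b z * (b z - w z) + c z * c z + d z * d z.
have bw2 : in_L2 mu2 Omega (fun z => b z - w z).
  exact: (in_L2B _ _ _ mu2 _ mO _ _ b2 dv2).
have ad2 : in_L2 mu2 Omega (fun z => a z + d z).
  have := in_L2_lin _ _ _ mu2 _ mO _ _ 1 1 a2 d2.
  by under eq_fun do rewrite !mul1r.
have iM (f f' : R * R -> R) : in_L2 mu2 Omega f -> in_L2 mu2 Omega f' ->
    mu2.-integrable Omega (EFin \o (fun z => f z * f' z)).
  exact: (in_L2_integrableM _ _ _ mu2 _ mO).
have iG : mu2.-integrable Omega (EFin \o G).
  have := @integrableD _ _ _ mu2 _ mO _ _ (@integrableD _ _ _ mu2 _ mO _ _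
    (@integrableD _ _ _ mu2 _ mO _ _ (iM a a a2 a2) (iM b _ b2 bw2))
    (iM c c c2 c2)) (iM d d d2 d2).
  by apply: eq_integrable => // z _ /=; rewrite !EFinD.
have ipd := iM _ _ p2 ad2.
rewrite (_ : integral _ _ _ = \int[mu2]_(z in Omega) (G z)%:E)%E; last first.
  apply: ae_eq_integral => //.
  - have := measurable_int _ (@integrableB _ _ _ mu2 _ mO _ _ iG ipd).
    by apply: eq_measurable_fun => z _ /=; rewrite EFinB.
  - exact: (measurable_int _ iG).
  - apply: (@negligibleS _ _ _ mu2 _ _ _ divu).
    by apply: subsetC => z divz Oz; rewrite /dpsi1 /= divz// mulr0 subr0.
move=> /(congr1 fine) /= G0.
have i1 := iM _ _ b2 b2; have i2 := iM _ _ dv2 dv2.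
have : \int[mu2]_(z in Omega) (2^-1 * (b z * b z) - 2^-1 * (w z * w z)) <= 0.
  rewrite -[leRHS]G0; apply: le_Rintegral => //.
    have := @integrableB _ _ _ mu2 _ mO _ _
      (@integrableZl _ _ _ mu2 _ mO 2^-1 _ i1)
      (@integrableZl _ _ _ mu2 _ mO 2^-1 _ i2).
    by apply: eq_integrable => // z _ /=; rewrite EFinB !EFinM.
  move=> z _; rewrite /G.
  have := sqr_ge0 (b z - w z); have := sqr_ge0 (a z); have := sqr_ge0 (c z).
  have := sqr_ge0 (d z); nra.
rewrite RintegralB//.
- rewrite !RintegralZl// subr_le0 ler_pM2l ?invr_gt0//.
- exact: (@integrableZl _ _ _ mu2 _ mO 2^-1 _ i1).
- exact: (@integrableZl _ _ _ mu2 _ mO 2^-1 _ i2).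
Qed.

End RoughDomain.

(** * Bounds on the slice integrals of the two flows *)

Section FlowBounds.
Context {R : realType}.
Notation mu1 := (@lebesgue_measure R).
Notation mu2 := (mu1 \x mu1)%E.
Variables (phi : R -> R) (eps g : R).
Hypotheses (phi_bounded : bounded_fun phi).
Hypotheses (phi_lipschitz : exists k : R, k.-lipschitz phi).
Hypotheses (phi_ge0 : forall x, 0 <= phi x).
Hypotheses (eps0 : 0 < eps) (g0 : 0 < g).

Let h := rough_bottom phi eps.
Let M := eps * sup_norm phi.
Let Omega := Omega_mic phi eps g.

(** The factors [eps * g] and [eps * (g + M)] are the areas of the rectangle above
    [x_2 = 0], from the Cauchy-Schwarz inequality, and of a box that contains the
    domain, from the energy of the shear flow. *)
Lemma slice_bound (u : R * R -> R * R) (p : R * R -> R) (v dv : R -> R)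
    (b K : R) :
  stokes_periodic phi eps g u p ->
  (forall y : R, is_derive y (1 : R) v (dv y)) -> continuous dv ->
  (forall y, - M < y < g -> `|dv y| <= K) ->
  vtrace_on eps Omega h u (fun x => (v (h x), 0)) ->
  vtrace_on eps Omega (cst g) u (cst (v g, 0)) ->
  slice_integral phi eps g u b ->
  (eps * v g - b) ^+ 2 <= eps ^+ 2 * g * (g + M) * K ^+ 2.
Proof.
move=> [p2 [du1 [du2 [Hdu divu weak]]]] v_dv cdv dvK [bot1 bot2] [top1 top2].
move=> [tau tau_trace ->].
have mO := measurable_Omega phi eps g phi_lipschitz.
have mS := measurable_strip eps g.
have SO := strip_Omega phi eps g phi_bounded phi_ge0 eps0.
have M0 : 0 <= M by apply: mulr_ge0; [exact: ltW|exact: sup_norm_ge0].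
have Mg : - M < g by apply: le_lt_trans g0; rewrite oppr_le0.
have Obox := Omega_box phi eps g phi_ge0 eps0.
have energy := shear_energy phi eps g phi_bounded phi_lipschitz phi_ge0 eps0 g0
  v dv v_dv cdv u p bot1 bot2 top1 top2 du1 du2 p2 Hdu divu weak.
have [Hdu1 _] := Hdu; have [_ _ b2 _] := Hdu1.
have b2S := in_L2S _ _ mu2 _ _ _ mS mO SO b2.
have := strip_increment _ _ _ _ _ _ _ eps0 g0 mO SO Hdu1 tau_trace top1.
rewrite (_ : \int[mu1]_(x in _) (fst \o _) x = eps * v g) => [<-|]; last first.
  rewrite Rintegral_cst// mulrC; congr (_ * _).
  by have := congr1 fine (lebesgue_measure_itv0 _ (ltW eps0)).
have one2 : in_L2 mu2 (strip eps g) (fun=> 1).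
  apply: (continuous_in_L2_strip eps g (cst 1)) => // z; exact: cvg_cst.
have := cauchy_schwarz _ _ _ mu2 _ mS _ _ b2S one2.
under eq_Rintegral do rewrite /= mulr1.
move=> /le_trans; apply.
have -> : \int[mu2]_(z in strip eps g) (1 ^+ 2) = eps * g.
  rewrite expr1n Rintegral_cst// mul1r.
  exact: (congr1 fine (strip_measure _ _ (ltW eps0) (ltW g0))).
have dv2 := shear_in_L2 _ _ _ _ eps0 Mg mO Obox _ cdv.
have K0 : 0 <= K.
  apply: le_trans (normr_ge0 _) (dvK (g / 2) _).
  apply/andP; split; last by rewrite ltr_pdivrMr// ltr_pMr// ltr1n.
  by apply: (@le_lt_trans _ _ 0); rewrite ?oppr_le0 ?divr_gt0.
have le1 : \int[mu2]_(z in strip eps g) ((du1 z).2 ^+ 2) <=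
    \int[mu2]_(z in Omega) ((du1 z).2 ^+ 2).
  have i1 := in_L2_integrable_sqr _ _ _ mu2 _ _ b2S.
  have i2 := in_L2_integrable_sqr _ _ _ mu2 _ _ b2.
  apply: fine_le; [exact: (@integrable_fin_num _ _ _ mu2 _ mS _ i1)|
    exact: (@integrable_fin_num _ _ _ mu2 _ mO _ i2)|].
  apply: ge0_subset_integral => //; first exact: (measurable_int _ i2).
  by move=> z _; rewrite lee_fin sqr_ge0.
have le2 : \int[mu2]_(z in Omega) (dv z.2 ^+ 2) <= K ^+ 2 * (eps * (g + M)).
  have cK : continuous (cst K : R -> R) by move=> y; exact: cvg_cst.
  have K2 := shear_in_L2 _ _ _ _ eps0 Mg mO Obox _ cK.
  apply: (@le_trans _ _ (\int[mu2]_(z in Omega) (K ^+ 2))).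
    apply: le_Rintegral => //.
    - exact: (in_L2_integrable_sqr _ _ _ mu2 _ _ dv2).
    - exact: (in_L2_integrable_sqr _ _ _ mu2 _ _ K2).
    - move=> z /Obox[_ /=]; rewrite in_itv/= => /dvK dvzK.
      by rewrite -(real_normK (num_real (dv z.2))) lerXn2r// nnegrE.
  rewrite Rintegral_cst//; apply: ler_wpM2l; first exact: sqr_ge0.
  have := box_measure _ _ _ _ eps0 Mg mO Obox; rewrite opprK => muO.
  rewrite -lee_fin fineK//.
  by rewrite ge0_fin_numE//; exact: le_lt_trans muO (ltry _).
apply: (@le_trans _ _ (K ^+ 2 * (eps * (g + M)) * (eps * g))).
  apply: ler_wpM2r; first by rewrite ltW// mulr_gt0.
  by apply: le_trans le1 _; apply: le_trans energy _.
by rewrite le_eqVlt; apply/orP; left; apply/eqP; ring.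
Qed.

(** The data on the rough boundary depend on [x_2] only, and the polynomial that
    defines them also satisfies the condition at the top. *)
Lemma flow_u2_bound (u : R * R -> R * R) (p : R * R -> R) (b : R) :
  flow_u2 phi eps g u p -> slice_integral phi eps g u b ->
  b ^+ 2 <= eps ^+ 2 * g * (g + M) ^+ 3.
Proof.
move=> [ust top bot] slice.
pose v y : R := - ((y + M) * (g - y)).
pose dv y : R := 2 * y + (M - g).
have v_dv (y : R) : is_derive y (1 : R) v (dv y).
  rewrite (_ : v = (id + cst M) * (id - cst g)); last first.
    by apply/funext => x; rewrite /v !fctE; ring.
  apply: is_derive_eq; rewrite /dv /GRing.scale/= !fctE/=. ring.
have cdv : continuous dv.
  by move=> y; apply: cvgD; [apply: cvgMl_tmp; exact: cvg_id|exact: cvg_cst].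
have vg : v g = 0 by rewrite /v subrr mulr0 oppr0.
have := slice_bound u p v dv b (g + M) ust v_dv cdv.
rewrite vg mulr0 sub0r sqrrN -mulrA -exprS; apply => //.
- by move=> y /andP[y1 y2]; rewrite /dv ler_norml; apply/andP; split; lra.
- rewrite (_ : (fun x => _) = (fun x => (- ((h x + M) * (g - h x))) *: e1))//.
  by apply/funext => x; congr pair; apply/esym; [exact: mulr1|exact: mulr0].
Qed.

Lemma is_derive_pos_part_sqr (y : R) :
  is_derive y (1 : R) (fun y => Num.max 0 y ^+ 2) (2 * Num.max 0 y).
Proof.
have [y0|y0|->] := ltgtP y 0.
- rewrite mulr0.
  apply: (@near_eq_is_derive R R R (cst 0)).
  near=> z; rewrite max_l ?expr0n//= ltW//.
  by near: z; exact: lt_nbhsl.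
- apply: (@near_eq_is_derive R R R (id ^+ 2)).
    near=> z; rewrite max_r ?exprfctE// ltW//.
    by near: z; exact: lt_nbhsr.
  by apply: is_derive_eq; rewrite /GRing.scale/= expr1 mulr1.
- rewrite mulr0.
  have L : (fun k : R => k^-1 *: (Num.max 0 (k *: (1 : R) + 0 : R) ^+ 2
      - Num.max 0 (0 : R) ^+ 2)) @ 0^' --> (0 : R).
    apply/cvgr0Pnorm_le => e e0; near=> k.
    rewrite maxxx expr0n subr0 addr0 /GRing.scale/= mulr1.
    have k0 : k != 0 by near: k; exact: nbhs_dnbhs_neq.
    apply: (@le_trans _ _ `|k|).
      rewrite normrM normfV ler_pdivrMl ?normr_gt0// normrX -expr2 lerXn2r ?nnegrE//.
      by rewrite ger0_norm ?le_max ?lexx// ge_max normr_ge0 ler_norm.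
    near: k; apply: dnbhs0_le => //.
  by split; [apply/cvg_ex; exists 0|exact: (cvg_lim (@Rhausdorff R) L)].
Unshelve. all: by end_near. Qed.

(** The square makes the profile continuously differentiable across [x_2 = 0], at
    the cost of a factor 2 in its slope compared with a piecewise affine one. *)
Lemma flow_u3_bound (u : R * R -> R * R) (p : R * R -> R) (b : R) :
  flow_u3 phi eps g u p -> slice_integral phi eps g u b ->
  (eps - b) ^+ 2 <= 4 * eps ^+ 2 * (1 + M / g).
Proof.
move=> [ust top bot] slice.
pose v y : R := g ^- 2 * Num.max 0 y ^+ 2.
pose dv y : R := g ^- 2 * (2 * Num.max 0 y).
have v_dv (y : R) : is_derive y (1 : R) v (dv y).
  have ? := is_derive_pos_part_sqr y.
  rewrite (_ : v = g ^- 2 *: (fun y : R => Num.max 0 y ^+ 2 : R))//.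
  by apply: is_derive_eq.
have cdv : continuous dv.
  move=> y; apply: cvgMl_tmp; apply: cvgMl_tmp.
  by apply: continuous_max; [exact: cvg_cst|exact: cvg_id].
have vg : v g = 1 by rewrite /v max_r ?ltW// mulVf// expf_neq0// gt_eqF.
have := slice_bound u p v dv b (2 / g) ust v_dv cdv.
rewrite vg mulr1.
have -> : eps ^+ 2 * g * (g + M) * (2 / g) ^+ 2 = 4 * eps ^+ 2 * (1 + M / g).
  by field; rewrite gt_eqF.
apply => //.
- move=> y /andP[y1 y2]; rewrite /dv ger0_norm; last first.
    by rewrite mulr_ge0 ?invr_ge0 ?sqr_ge0// mulr_ge0// le_max lexx.
  apply: (@le_trans _ _ (g ^- 2 * (2 * g))).
    by rewrite !ler_pM2l ?invr_gt0 ?exprn_gt0// ge_max !ltW.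
  by rewrite le_eqVlt; apply/orP; left; apply/eqP; field; rewrite gt_eqF.
- rewrite (_ : (fun x => _) = cst 0)//; apply/funext => x.
  rewrite /v max_l ?expr0n ?mulr0//.
  exact: rough_bottom_le0.
Qed.

End FlowBounds.

(** * Composition of the two maps *)

Section Algebra.
Context {R : realFieldType}.

Lemma homography_sub (c1 c2 c3 k x y : R) : c3 + k * x != 0 -> c3 + k * y != 0 ->
  (c1 + c2 * y) / (c3 + k * y) - (c1 + c2 * x) / (c3 + k * x) =
  (c2 * c3 - c1 * k) * (y - x) / ((c3 + k * x) * (c3 + k * y)).
Proof. by move=> x0 y0; field; rewrite x0 y0. Qed.

End Algebra.

Section AlgebraReal.
Context {R : realType}.


Lemma T2_0 (g1 g2 : R) : g1 - 1 != 0 -> T2 g1 g2 0 = (g2 - g1) * (1 - g2).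
Proof. by move=> g10; rewrite /T2 /T2_den !subr0; field. Qed.

Lemma T2_sub0 (g1 g2 al : R) : g1 - 1 != 0 -> g1 - 1 - al != 0 ->
  T2 g1 g2 al - T2 g1 g2 0 =
  al * (1 - g1) * (1 - g2) / (1 - g1 + al).
Proof.
move=> g10 al0; have al1 : 1 - g1 + al != 0.
  by rewrite -oppr_eq0 (_ : - (1 - g1 + al) = g1 - 1 - al)//; ring.
by rewrite /T2 /T2_den subr0; field; rewrite g10 al0 al1.
Qed.

Lemma C2_bound (C eps g1 g2 B3 : R) :
  1 <= C -> 0 < g1 -> g1 <= g2 -> eps * g2 <= g1 -> `|B3| <= C * eps ->
  `|C2 g1 g2 B3| <= 2 * C * g1.
Proof.
move=> C1_ g10 g12 rs B3s; have g20 : 0 < g2 := lt_le_trans g10 g12.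
apply: (@le_trans _ _ (`|B3| * g2 + g1)).
  apply: le_trans (ler_normD _ _) _; rewrite normrM (gtr0_norm g10) lerD2r.
  by rewrite ler_wpM2l// ger0_norm ?subr_ge0// gerBl ltW.
have h1 : `|B3| * g2 <= C * (eps * g2) by rewrite mulrA ler_wpM2r// ltW.
have h2 : C * (eps * g2) <= C * g1 by rewrite ler_wpM2l// (le_trans ler01).
by clear -C1_ g10 h1 h2; nra.
Qed.

Lemma C3_bound (C eps M g1 g2 B2 : R) :
  1 <= C -> 0 < eps -> 0 < g1 -> g1 <= g2 -> 0 <= M -> M <= g2 ->
  `|B2| <= C * eps * g2 ^+ 2 ->
  `|C3 eps M g1 g2 B2| <= 3 * C * eps * g2 ^+ 2.
Proof.
move=> C1_ e0 g10 g12 M0 Mg B2s; have g20 : 0 < g2 := lt_le_trans g10 g12.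
have eg2 : 0 < eps * g2 by rewrite mulr_gt0.
apply: (@le_trans _ _ (eps * g2 * (2 * g2) + `|B2|)).
  apply: le_trans (ler_normB _ _) _; rewrite lerD2r normrM (gtr0_norm eg2).
  rewrite ler_wpM2l ?(ltW eg2)// ler_norml.
  by clear -g10 g12 M0 Mg; apply/andP; split; lra.
have egg : 0 < eps * g2 ^+ 2 by rewrite mulr_gt0// exprn_gt0.
have -> : eps * g2 * (2 * g2) = 2 * (eps * g2 ^+ 2) by ring.
move: B2s; rewrite -!(mulrA _ eps) => B2s.
by clear -B2s egg C1_; nra.
Qed.

Lemma C1_bound (C eps M g1 g2 B2 : R) :
  1 <= C -> 0 < eps -> 0 < g1 -> 0 <= M -> g1 + M <= g2 ->
  `|B2| <= C * eps * g2 ^+ 2 ->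
  `|C1 eps M g1 g2 B2| <= 2 * C * eps * g2 ^+ 3.
Proof.
move=> C1_ e0 g10 M0 gM B2s.
have g12 : g1 <= g2 by apply: le_trans gM; rewrite lerDl.
have g20 : 0 < g2 := lt_le_trans g10 g12.
have eg2 : 0 < eps * g2 by rewrite mulr_gt0.
have -> : C1 eps M g1 g2 B2 = (eps * g2 * (g1 + M) + B2) * (g2 - g1).
  by rewrite /C1; ring.
apply: (@le_trans _ _ ((eps * g2 ^+ 2 + C * eps * g2 ^+ 2) * g2)).
  rewrite normrM ler_pM//; last first.
    by rewrite ger0_norm ?subr_ge0// gerBl ltW.
  apply: le_trans (ler_normD _ _) _; rewrite lerD// normrM (gtr0_norm eg2).
  by rewrite expr2 mulrA ler_wpM2l ?(ltW eg2)// ger0_norm// addr_ge0// ltW.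
have egg : 0 < eps * g2 ^+ 3 by rewrite mulr_gt0// exprn_gt0.
have -> : (eps * g2 ^+ 2 + C * eps * g2 ^+ 2) * g2 = (1 + C) * (eps * g2 ^+ 3).
  by ring.
by rewrite -(mulrA (2 * C)) ler_wpM2r ?(ltW egg)//; clear -C1_; lra.
Qed.

(** The macroscopic values stay comparable to [g2], which dominates the denominator
    of [T1]; the numerator of [T1] gives [T U0 = O(g1)], hence [U1 - U0 = O(g1)],
    and the determinant [C2 * C3 - C1 * (1 - B3)] is [O(eps * g2 ^+ 3)].  The
    condition [eps * g2 <= g1] keeps the contributions of [C1] and [B3] to [T U0]
    at most of order [g1]. *)
Lemma alpha_increment (C eps M g1 g2 B2 B3 : R) :
  1 <= C -> 0 < eps -> 0 < g1 -> 0 < g2 ->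
  100 * C * g2 <= 1 -> 100 * C * g1 <= g2 -> 100 * C * eps <= g2 ->
  eps * g2 <= g1 -> 0 <= M -> M <= C * eps ->
  `|B2| <= C * eps * g2 ^+ 2 -> `|B3| <= C * eps ->
  let T := T1 eps M g1 g2 B2 B3 in
  let den := T1_den eps M g1 g2 B2 B3 in
  let U0 := T2 g1 g2 0 in let U1 := T2 g1 g2 (T U0) in
  [/\ T2_den g1 0 != 0, den U0 != 0, T2_den g1 (T U0) != 0, den U1 != 0 &
      `|T U1 - T U0| <= 960 * C ^+ 3 * eps * g1 * g2].
Proof.
move=> C1_ e0 g10 g20 g2s g1s es rs M0 Ms B2s B3s T den U0 U1.
have g2h : 100 * g2 <= 1 by clear -C1_ g20 g2s; nra.
have g1h : 100 * g1 <= g2 by clear -C1_ g10 g1s; nra.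
have eh : 100 * eps <= g2 by clear -C1_ e0 es; nra.
have g12 : g1 <= g2 by clear -g1h g20; lra.
have g11 : g1 - 1 != 0 by rewrite lt_eqF//; clear -g2h g1h; lra.
have Mg : g1 + M <= g2 by clear -Ms es g1h g20; lra.
have k2s := C2_bound C eps g1 g2 B3 C1_ g10 g12 rs B3s.
have k3s : `|C3 eps M g1 g2 B2| <= 3 * C * eps * g2 ^+ 2.
  by apply: C3_bound => //; clear -Mg g10; lra.
have k1s := C1_bound C eps M g1 g2 B2 C1_ e0 g10 M0 Mg B2s.
set k1 := C1 eps M g1 g2 B2 in k1s *; set k2 := C2 g1 g2 B3 in k2s *.
set k3 := C3 eps M g1 g2 B2 in k3s *.
have denE U : den U = k3 + (1 - B3) * U by [].
have alE U : T U = (k1 + k2 * U) / den U by [].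
clearbody k1 k2 k3.
have U0E : U0 = (g2 - g1) * (1 - g2) by exact: T2_0.
have U0l : 98 / 100 * g2 <= U0 by rewrite U0E; clear -g20 g10 g2h g1h; nra.
have U0u : U0 <= g2 by rewrite U0E; clear -g20 g10 g2h g1h; nra.
have U0p : 0 <= U0 by clear -U0l g20; lra.
have B3small : `|B3| <= 1 / 100.
  by apply: le_trans B3s _; clear -es g2h; lra.
have k3small : `|k3| <= 5 / 100 * g2.
  apply: le_trans k3s _.
  have -> : 3 * C * eps * g2 ^+ 2 = 3 * (C * g2) * eps * g2 by ring.
  rewrite ler_wpM2r ?(ltW g20)//.
  have Cg : 100 * (C * g2) <= 1 by rewrite mulrA.
  by clear -e0 Cg eh g2h; nra.
have den_big U : 7 / 10 * g2 <= U -> g2 / 2 <= den U.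
  move=> Ul; rewrite denE; move: k3small B3small.
  rewrite !ler_norml => /andP[? _] /andP[_ ?].
  have : 99 / 100 * U <= (1 - B3) * U.
    apply: ler_wpM2r; first by clear -g20 Ul; lra.
    by lra.
  lra.
have half_gt0 x : g2 / 2 <= x -> 0 < x.
  by apply: lt_le_trans; rewrite divr_gt0.
have d0 : g2 / 2 <= den U0 by apply: den_big; clear -U0l g20; lra.
have d0p := half_gt0 _ d0.
have Cg1 : 0 < C * g1 by rewrite mulr_gt0// (lt_le_trans ltr01).
have als : `|T U0| <= 10 * C * g1.
  rewrite alE normrM normfV (gtr0_norm d0p) ler_pdivrMr//.
  apply: (@le_trans _ _ (10 * C * g1 * (g2 / 2))); last first.
    by rewrite ler_wpM2l// -mulrA mulr_ge0// ltW.
  apply: (@le_trans _ _ (2 * C * eps * g2 ^+ 3 + 2 * C * g1 * g2)).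
    apply: le_trans (ler_normD _ _) _; rewrite lerD// normrM ler_pM//.
    by rewrite ger0_norm.
  have h1 : 2 * C * eps * g2 ^+ 3 <= 2 * C * g1 * g2.
    apply: (@le_trans _ _ (2 * (C * g1) * g2 * g2)).
      have -> : 2 * C * eps * g2 ^+ 3 = (2 * C * g2 ^+ 2) * (eps * g2) by ring.
      have -> : 2 * (C * g1) * g2 * g2 = (2 * C * g2 ^+ 2) * g1 by ring.
      by rewrite ler_wpM2l// mulr_ge0 ?sqr_ge0// mulr_ge0// (le_trans ler01).
    rewrite mulrA ler_piMr//; last by clear -g2h g20; lra.
    by rewrite -(mulrA 2 C) mulr_ge0 ?(ltW g20)// mulr_ge0 ?(ltW Cg1).
  have : 0 < C * g1 * g2 by rewrite mulr_gt0.
  by clear -h1; lra.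
set al := T U0 in als *.
have alsmall : `|al| <= 1 / 10 by apply: le_trans als _; clear -g1s g2h; lra.
have den2 : 1 / 2 <= 1 - g1 + al.
  by move: alsmall; rewrite ler_norml => /andP[+ _]; clear -g1h g2h; lra.
have al2 : g1 - 1 - al != 0 by rewrite lt_eqF//; clear -den2; lra.
have dU : `|U1 - U0| <= 20 * C * g1.
  have den2p : 0 < 1 - g1 + al by clear -den2; lra.
  rewrite /U1 -/al /U0 T2_sub0// normrM normfV (gtr0_norm den2p) ler_pdivrMr//.
  apply: (@le_trans _ _ (10 * C * g1)); last by clear -den2 Cg1; nra.
  apply: le_trans als; rewrite -mulrA normrM ler_piMr//.
  have x1 : 0 <= 1 - g1 <= 1 by clear -g10 g1h g2h; apply/andP; split; lra.
  have x2 : 0 <= 1 - g2 <= 1 by clear -g20 g2h; apply/andP; split; lra.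
  case/andP: x1 => x1 x1'; case/andP: x2 => x2 x2'.
  by rewrite ger0_norm ?mulr_ge0// mulr_ile1.
have d1 : g2 / 2 <= den U1.
  apply: den_big; move: dU; rewrite ler_norml => /andP[+ _].
  by clear -g1s U0l g20; lra.
have d1p := half_gt0 _ d1.
split.
- by rewrite /T2_den subr0.
- by rewrite gt_eqF.
- exact: al2.
- by rewrite gt_eqF.
rewrite alE /al alE !denE homography_sub -?denE ?gt_eqF//.
rewrite !normrM normfV normrM (gtr0_norm d0p) (gtr0_norm d1p).
have dd : g2 ^+ 2 / 4 <= den U0 * den U1.
  have -> : g2 ^+ 2 / 4 = (g2 / 2) * (g2 / 2) by field.
  by rewrite ler_pM// ltW// divr_gt0.
(* 960 = 12 * 20 * 4: determinant, increment of U, and both denominators. *)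
have num : `|k2 * k3 - k1 * (1 - B3)| <= 12 * C ^+ 2 * (eps * g2 ^+ 3).
  have B31 : `|1 - B3| <= 2.
    apply: le_trans (ler_normB _ _) _; rewrite normr1.
    by clear -B3small; lra.
  have egg3 : 0 < eps * g2 ^+ 3 by rewrite mulr_gt0// exprn_gt0.
  have egg : 0 < eps * g2 ^+ 2 by rewrite mulr_gt0// exprn_gt0.
  apply: (@le_trans _ _ (2 * C * g1 * (3 * C * eps * g2 ^+ 2) +
      2 * C * eps * g2 ^+ 3 * 2)).
    by apply: le_trans (ler_normB _ _) _; rewrite !normrM lerD// ler_pM.
  have h1 : 2 * C * g1 * (3 * C * eps * g2 ^+ 2) <= 6 * C ^+ 2 * (eps * g2 ^+ 3).
    have -> : 2 * C * g1 * (3 * C * eps * g2 ^+ 2) =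
      6 * C ^+ 2 * (eps * g2 ^+ 2) * g1 by ring.
    have -> : 6 * C ^+ 2 * (eps * g2 ^+ 3) =
      6 * C ^+ 2 * (eps * g2 ^+ 2) * g2 by ring.
    by rewrite ler_wpM2l// mulr_ge0 ?(ltW egg)// mulr_ge0// sqr_ge0.
  have h2 : 2 * C * eps * g2 ^+ 3 * 2 <= 6 * C ^+ 2 * (eps * g2 ^+ 3).
    have -> : 2 * C * eps * g2 ^+ 3 * 2 = 4 * C * (eps * g2 ^+ 3) by ring.
    by rewrite ler_wpM2r ?(ltW egg3)//; clear -C1_; nra.
  apply: le_trans (lerD h1 h2) _.
  by rewrite -mulrDl -mulrDl; apply: ler_wpM2r; [exact: ltW|clear; lra].
rewrite ler_pdivrMr ?mulr_gt0//.
apply: (@le_trans _ _ (12 * C ^+ 2 * (eps * g2 ^+ 3) * (20 * C * g1))).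
  by rewrite ler_pM.
apply: (@le_trans _ _ (960 * C ^+ 3 * eps * g1 * g2 * (g2 ^+ 2 / 4))).
  by rewrite le_eqVlt; apply/orP; left; apply/eqP; field.
have K0 : 0 <= 960 * C ^+ 3.
  by apply: mulr_ge0; [exact: ler0n|rewrite exprn_ge0// (le_trans ler01)].
apply: ler_wpM2l dd.
exact: (mulr_ge0 (mulr_ge0 (mulr_ge0 K0 (ltW e0)) (ltW g10)) (ltW g20)).
Qed.

End AlgebraReal.

(** * Asymptotics as eps tends to 0 *)

Lemma near0_powR_le (R : realType) (a c : R) : 0 < a -> 0 < c ->
  \forall eps \near (0 : R)^'+, eps `^ a <= c.
Proof.
move=> a0 c0; near=> eps.
have eps0 : 0 <= eps by near: eps; exact: nbhs_right_ge.
apply: (@le_trans _ _ ((c `^ a^-1) `^ a)).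
  apply: ge0_ler_powR; rewrite ?nnegrE ?powR_ge0//; first exact: ltW.
  by near: eps; apply: nbhs_right_le; exact: powR_gt0.
by rewrite -powRrM mulVf ?gt_eqF// powRr1// ltW.
Unshelve. all: by end_near. Qed.

Section ScaledBounds.
Context {R : realType}.

(** For [eps <= g] the roughness amplitude [eps * H] is at most [g * H], so that
    both bounds hold with a constant that depends on [H] only. *)
Lemma flow_bounds_scaled (H eps g b2 b3 : R) :
  0 <= H -> 0 < eps -> 0 < g -> eps <= g ->
  b2 ^+ 2 <= eps ^+ 2 * g * (g + eps * H) ^+ 3 ->
  (eps - b3) ^+ 2 <= 4 * eps ^+ 2 * (1 + eps * H / g) ->
  `|b2| <= 4 * (1 + H) ^+ 2 * eps * g ^+ 2 /\ `|b3| <= 4 * (1 + H) ^+ 2 * eps.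
Proof.
move=> H0 e0 g0 eg b2s b3s.
have eH : eps * H <= g * H by rewrite ler_wpM2r.
have sq (x y : R) : 0 <= y -> x ^+ 2 <= y ^+ 2 -> `|x| <= y.
  by move=> y0; rewrite -(real_normK (num_real x)) ler_pXn2r// nnegrE.
have K0 : 0 <= 4 * (1 + H) ^+ 2 by rewrite mulr_ge0// sqr_ge0.
have H1 : 0 <= 1 + H by rewrite addr_ge0.
split.
  apply: sq; first by rewrite mulr_ge0 ?sqr_ge0// mulr_ge0 ?(ltW e0).
  apply: le_trans b2s _.
  apply: (@le_trans _ _ (eps ^+ 2 * g * (g * (1 + H)) ^+ 3)).
    rewrite ler_wpM2l//; first by rewrite mulr_ge0 ?sqr_ge0// ltW.
    rewrite lerXn2r// ?nnegrE.
    - by rewrite addr_ge0 ?(ltW g0)// mulr_ge0 ?(ltW e0).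
    - by rewrite mulr_ge0 ?(ltW g0).
    - by rewrite mulrDr mulr1 lerD2l.
  have -> : (4 * (1 + H) ^+ 2 * eps * g ^+ 2) ^+ 2 =
     eps ^+ 2 * g * (g * (1 + H)) ^+ 3 * (16 * (1 + H)) by ring.
  rewrite ler_peMr//; last by clear -H0; lra.
  rewrite mulr_ge0 ?exprn_ge0//; last by rewrite mulr_ge0 ?(ltW g0).
  by rewrite mulr_ge0 ?sqr_ge0 ?(ltW g0).
have : `|eps - b3| <= 2 * eps * (1 + H).
  apply: sq; first by rewrite mulr_ge0// mulr_ge0 ?(ltW e0).
  apply: le_trans b3s _.
  have -> : (2 * eps * (1 + H)) ^+ 2 = 4 * eps ^+ 2 * (1 + H) ^+ 2 by ring.
  apply: ler_wpM2l; first by rewrite mulr_ge0 ?sqr_ge0.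
  have : eps * H / g <= H by rewrite ler_pdivrMr// [leRHS]mulrC.
  move=> egH; apply: (@le_trans _ _ (1 + H)); first by rewrite lerD2l.
  by clear -H0; nra.
rewrite !ler_norml => /andP[b1 b4].
by clear -b1 b4 H0 e0; apply/andP; split; nra.
Qed.

End ScaledBounds.

Theorem theorem3p14 (R : realType) (phi : R -> R) (s t : R)
  (u2 u3 : R -> R * R -> R * R) (p2 p3 : R -> R * R -> R) (B2 B3 : R -> R)
  (phi_bounded : bounded_fun phi)
  (phi_lipschitz : exists k : R, k.-lipschitz phi)
  (phi_periodic : periodic phi 1)
  (phi_ge0 : forall x, 0 <= phi x)
  (H_gt0 : 0 < sup_norm phi)
  (phi_int : forall N : int, phi N%:~R = sup_norm phi)
  (ht : 1 / 2 < t < 1) (hs : t < s < 1 + t) (hst : (t + 1) / 3 < s)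
  (hu2 : forall eps, 0 < eps < 1 ->
    flow_u2 phi eps (eps `^ t) (u2 eps) (p2 eps))
  (hu3 : forall eps, 0 < eps < 1 ->
    flow_u3 phi eps (eps `^ t) (u3 eps) (p3 eps))
  (hB2 : forall eps, 0 < eps < 1 ->
    slice_integral phi eps (eps `^ t) (u2 eps) (B2 eps))
  (hB3 : forall eps, 0 < eps < 1 ->
    slice_integral phi eps (eps `^ t) (u3 eps) (B3 eps)) :
  let gamma1 := fun eps : R => eps `^ s in
  let gamma2 := fun eps : R => eps `^ t in
  let M := fun eps : R => eps * sup_norm phi in
  let T1_ := fun eps =>
    T1 eps (M eps) (gamma1 eps) (gamma2 eps) (B2 eps) (B3 eps) in
  let T1_den_ := fun eps =>
    T1_den eps (M eps) (gamma1 eps) (gamma2 eps) (B2 eps) (B3 eps) in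
  let T2_ := fun eps => T2 (gamma1 eps) (gamma2 eps) in
  let T2_den_ := fun eps => T2_den (gamma1 eps) in
  let T_ := fun eps U => T2_ eps (T1_ eps U) in
  let U0 := fun eps => T2_ eps 0 in
  let U1 := fun eps => T_ eps (U0 eps) in
  let alpha0 := fun eps => T1_ eps (U0 eps) in
  let alpha1 := fun eps => T1_ eps (U1 eps) in
  (* the four quantities are well defined for all small eps *)
  (\forall eps \near 0^'+,
     [/\ T2_den_ eps 0 != 0, T1_den_ eps (U0 eps) != 0,
         T2_den_ eps (alpha0 eps) != 0 & T1_den_ eps (U1 eps) != 0]) /\
  (alpha1 eps - alpha0 eps) / eps ^+ 2 @[eps --> 0^'+] --> (0 : R).
Proof.
move=> gamma1 gamma2 M T1_ T1_den_ T2_ T2_den_ T_ U0 U1 alpha0 alpha1.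
move: ht hs => /andP[t2 t1] /andP[ts st].
have t0 : 0 < t by lra.
set H := sup_norm phi; pose C : R := 4 * (1 + H) ^+ 2.
have H0 : 0 < H := H_gt0.
have C1 : 1 <= C by rewrite /C; nra.
have HC : H <= C by rewrite /C; nra.
have small : \forall eps \near 0^'+,
    [/\ T2_den_ eps 0 != 0, T1_den_ eps (U0 eps) != 0,
        T2_den_ eps (alpha0 eps) != 0, T1_den_ eps (U1 eps) != 0 &
        `|alpha1 eps - alpha0 eps| <=
          960 * C ^+ 3 * eps * gamma1 eps * gamma2 eps].
  have c0 : 0 < (100 * C)^-1 by rewrite invr_gt0; lra.
  near=> eps.
  have e0 : 0 < eps by near: eps; exact: nbhs_right_gt.
  have e1 : eps < 1 by near: eps; apply: nbhs_right_lt; exact: ltr01.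
  have e01 : 0 < eps < 1 by rewrite e0 e1.
  have eN0 : eps != 0 by rewrite gt_eqF.
  have g10 : 0 < gamma1 eps by exact: powR_gt0.
  have g20 : 0 < gamma2 eps by exact: powR_gt0.
  have pow_split (a b c : R) : a + b = c -> eps `^ a * eps `^ b = eps `^ c.
    by move=> <-; rewrite powRD// eN0 implybT.
  have CK x : x <= (100 * C)^-1 -> 100 * C * x <= 1.
    by move=> xs; rewrite -ler_pdivlMl ?mulr1//; lra.
  have s1 : 100 * C * gamma2 eps <= 1.
    by apply: CK; near: eps; exact: near0_powR_le.
  have s2 : 100 * C * gamma1 eps <= gamma2 eps.
    rewrite /gamma1 -(pow_split (s - t) t); last by ring.
    rewrite mulrA ler_piMl ?powR_ge0//; apply: CK.
    by near: eps; apply: near0_powR_le => //; lra.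
  have s3 : 100 * C * eps <= gamma2 eps.
    have epsE : eps = eps `^ (1 - t) * gamma2 eps.
      by rewrite (pow_split _ _ 1) ?powRr1 ?ltW// subrK.
    rewrite [in leLHS]epsE mulrA ler_piMl ?powR_ge0//; apply: CK.
    by near: eps; apply: near0_powR_le => //; rewrite subr_gt0.
  have s4 : eps * gamma2 eps <= gamma1 eps.
    have -> : eps * gamma2 eps = eps `^ (1 + t - s) * gamma1 eps.
      by rewrite (pow_split _ _ (1 + t)) ?subrK// -(pow_split 1 t)// powRr1 ?ltW.
    rewrite ler_piMl ?powR_ge0//.
    by near: eps; apply: near0_powR_le => //; rewrite subr_gt0.
  have M0 : 0 <= M eps by rewrite mulr_ge0 ?(ltW e0) ?(ltW H0).
  have Ms : M eps <= C * eps by rewrite /M mulrC ler_wpM2r ?(ltW e0).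
  have b2 := flow_u2_bound phi eps (gamma2 eps) phi_bounded phi_lipschitz phi_ge0
    e0 g20 _ _ _ (hu2 _ e01) (hB2 _ e01).
  have b3 := flow_u3_bound phi eps (gamma2 eps) phi_bounded phi_lipschitz phi_ge0
    e0 g20 _ _ _ (hu3 _ e01) (hB3 _ e01).
  have eg : eps <= gamma2 eps by clear -s3 C1 e0; nra.
  have [b2s b3s] := flow_bounds_scaled H _ _ _ _ (ltW H0) e0 g20 eg b2 b3.
  exact: (alpha_increment _ _ _ _ _ _ _ C1 e0 g10 g20 s1 s2 s3 s4 M0 Ms b2s b3s).
split; first by apply: filterS small => eps [].
have K0 : 0 < 960 * C ^+ 3.
  by apply: mulr_gt0; [rewrite ltr0n|apply: exprn_gt0; exact: lt_le_trans C1].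
set K := 960 * C ^+ 3 in K0 small *.
apply/cvgr0Pnorm_le => e e_gt0; near=> eps.
have e0 : 0 < eps by near: eps; exact: nbhs_right_gt.
have inc : `|alpha1 eps - alpha0 eps| <= K * eps * gamma1 eps * gamma2 eps.
  by near: eps; apply: filterS small => eps [].
have pow : eps `^ (s + t - 1) <= e / K.
  by near: eps; apply: near0_powR_le; [lra|rewrite divr_gt0].
rewrite normrM normfV (gtr0_norm (exprn_gt0 2 e0)) ler_pdivrMr ?exprn_gt0//.
apply: le_trans inc _.
have gg : gamma1 eps * gamma2 eps = eps `^ (s + t - 1) * eps.
  rewrite -[X in _ = _ * X](powRr1 (ltW e0)) /gamma1 /gamma2.
  by rewrite -!powRD ?(gt_eqF e0) ?implybT// subrK.
rewrite -mulrA gg.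
have -> : K * eps * (eps `^ (s + t - 1) * eps) =
  (eps `^ (s + t - 1) * K) * eps ^+ 2 by ring.
by rewrite ler_wpM2r ?sqr_ge0// -ler_pdivlMr.
Unshelve. all: by end_near. Qed.
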